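(* Let $\rho$ be a (generally mixed) density matrix on $\mathcal H_A\otimes\mathcal H_B$ (finite-dimensional), used as a probe state, let $H_A$ be a Hermitian operator on $\mathcal H_A$ with nondegenerate spectrum $\bar\Lambda$, and let $\rho_\varphi=U_\varphi\rho U_\varphi^\dagger$ with $U_\varphi=e^{-i\varphi H_A}\otimes\mathbb I_B$, where $\varphi\in\mathbb R$ is the parameter to be estimated. Then $$\mathcal U_A^{\bar\Lambda}(\rho)\le\mathcal I(\rho,H_A\otimes\mathbb I_B)=\mathcal I(\rho_\varphi,H_A\otimes\mathbb I_B)\le\tfrac14\mathcal F(\rho_\varphi),$$ where $\mathcal U_A^{\bar\Lambda}$ is the local quantum uncertainty, $\mathcal I$ the skew information and $\mathcal F$ the quantum Fisher information. Consequently, if $\rho$ has any nonzero amount of discord (with respect to measurements on $A$), then for $\nu\gg1$ repetitions of the experiment, the optimal detection strategy, which asymptotically saturates the quantum Cramér-Rao bound, produces an estimator $\tilde\varphi_{\rm best}$ of $\varphi$ whose variance is necessarily limited, scaling as $$\mathrm{Var}(\tilde\varphi_{\rm best})=\frac{1}{\nu\mathcal F(\rho_\varphi)}\le\frac{1}{4\nu\,\mathcal U_A^{\bar\Lambda}(\rho)}.$$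
   Context: For a density matrix $\rho$ and a Hermitian operator $K$, the Wigner-Yanase skew information is $\mathcal I(\rho,K)=-\tfrac12\mathrm{Tr}\{[\rho^{1/2},K]^2\}$. For a nondegenerate spectrum $\Lambda$ (a list of $\dim\mathcal H_A$ pairwise distinct real numbers), the local quantum uncertainty is $\mathcal U_A^\Lambda(\rho)=\min_{K_A}\mathcal I(\rho,K_A\otimes\mathbb I_B)$, the minimum being over all Hermitian operators $K_A$ on $\mathcal H_A$ with spectrum $\Lambda$, i.e. $K_A=V\,\mathrm{diag}(\Lambda)\,V^\dagger$ with $V$ unitary. The state $\rho$ has zero discord with respect to measurements on $A$ if $\rho=\sum_i p_i|i\rangle\langle i|_A\otimes\tau_i$ for some orthonormal basis $\{|i\rangle\}$ of $\mathcal H_A$, probabilities $p_i$ and states $\tau_i$ of $B$; otherwise it has nonzero discord. For any nondegenerate $\Lambda$, $\mathcal U_A^\Lambda(\rho)=0$ if and only if $\rho$ has zero discord with respect to measurements on $A$. The quantum Fisher information is $\mathcal F(\rho_\varphi)=\mathrm{Tr}\{\rho_\varphi L_\varphi^2\}$, where the symmetric logarithmic derivative $L_\varphi$ is defined implicitly by $2\,\partial_\varphi\rho_\varphi=L_\varphi\rho_\varphi+\rho_\varphi L_\varphi$. The quantum Cramér-Rao bound says that an unbiased estimator $\tilde\varphi$ of $\varphi$ constructed from measurements on $\rho_\varphi$, with the experiment repeated $\nu$ times, satisfies $\mathrm{Var}(\tilde\varphi)\ge1/[\nu\mathcal F(\rho_\varphi)]$. For any probe state there is a measurement strategy saturating this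 bound asymptotically (in the regime $\nu\gg1$); $\tilde\varphi_{\rm best}$ denotes the estimator obtained from this optimal strategy, so that $\mathrm{Var}(\tilde\varphi_{\rm best})=1/[\nu\mathcal F(\rho_\varphi)]$, understood in that asymptotic sense. Apart from the possible mixedness of the probe, the estimation process is noiseless. *)

(* Defs.v *)
From HB Require Import structures.
From mathcomp Require Import all_boot all_order all_algebra.
From mathcomp Require Import all_classical all_reals all_analysis.
From mathcomp Require Import complex.
From mathcomp Require mxtens.
Set Implicit Arguments.
Unset Strict Implicit.
Unset Printing Implicit Defensive.
Import Order.TTheory GRing.Theory Num.Theory.
Import numFieldNormedType.Exports.
Local Open Scope classical_set_scope.
Local Open Scope ring_scope.
Local Open Scope sesquilinear_scope.

(* [complex R] is the field of complex numbers over [R : realType]; [M ^t*] is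
   the conjugate transpose. H_A (x) H_B, with dim H_A = m and dim H_B = n, is
   represented by column vectors of size m * n, and [A *t B] is the Kronecker
   product. *)
Notation "A *t B" := (mxtens.tensmx A B)
  (at level 40, left associativity) : ring_scope.

Section Matrices.
Variable R : realType.
Local Notation C := (complex R).

Definition psdmx d (A : 'M[C]_d) : Prop :=
  A \is hermsymmx /\ forall x : 'cV[C]_d, 0 <= (x ^t* *m A *m x) 0 0.

Definition density d (rho : 'M[C]_d) : Prop := psdmx rho /\ \tr rho = 1.

(* [spectralmx A] is unitary, with
   A = (spectralmx A)^-1 *m diag_mx (spectral_diag A) *m spectralmx A
   for normal A; on psd matrices this is the psd square root. *)
Definition sqrtmx d (A : 'M[C]_d) : 'M[C]_d :=
  (spectralmx A) ^t* *m diag_mx (map_mx sqrtC (spectral_diag A))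
    *m spectralmx A.

Definition expmx d (A : 'M[C]_d) : 'M[C]_d :=
  limn (series (fun k : nat => (k`!%:R : C)^-1 *: A ^+ k)).

(* Derivative of a matrix-valued function of a real parameter, entrywise. *)
Definition mxderive d (f : R -> 'M[C]_d) (t : R) : 'M[C]_d :=
  \matrix_(i, j) Complex (derive1 (fun s => complex.Re (f s i j)) t)
                         (derive1 (fun s => complex.Im (f s i j)) t).

(* The Hermitian operators with spectrum Lam are the
   V diag(Lam) V^dagger with V unitary. *)
Definition conj_diag m (V : 'M[C]_m) (Lam : 'rV[R]_m) : 'M[C]_m :=
  V *m diag_mx (map_mx (real_complex R) Lam) *m V ^t*.

Definition has_spectrum m (Lam : 'rV[R]_m) (K : 'M[C]_m) : Prop :=
  exists2 V : 'M[C]_m, V \is unitarymx & K = conj_diag V Lam.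

Definition nondegenerate_spectrum m (Lam : 'rV[R]_m) : Prop :=
  injective (Lam 0).

(* The trace is real: [sqrt rho, K] is anti-Hermitian for Hermitian K. *)
Definition skew_info d (rho K : 'M[C]_d) : R :=
  let c := sqrtmx rho *m K - K *m sqrtmx rho in
  complex.Re (- 2^-1 * \tr (c *m c)).

Definition minimum (S : set R) : R := xget 0 [set u | S u /\ lbound S u].

(* Local quantum uncertainty with respect to the first factor. The minimum is
   attained, the unitary group being compact. *)
Definition lqu m n (Lam : 'rV[R]_m) (rho : 'M[C]_(m * n)) : R :=
  minimum [set skew_info rho (K *t (1%:M : 'M[C]_n)) |
             K in [set K : 'M[C]_m | has_spectrum Lam K]].

(* The columns of the unitary W are the kets |i> of an orthonormal basis. *)
Definition zero_discord m n (rho : 'M[C]_(m * n)) : Prop :=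
  exists (W : 'M[C]_m) (p : 'I_m -> R) (tau : 'I_m -> 'M[C]_n),
    [/\ W \is unitarymx,
        (forall i, 0 <= p i) /\ \sum_i p i = 1,
        forall i, density (tau i) &
        rho = \sum_i (real_complex R (p i)) *:
                ((col i W *m (col i W) ^t*) *t tau i)].

(* U_phi rho U_phi^dagger with U_phi = exp(- i phi H) (x) 1. *)
Definition evolution m (n : nat) (H : 'M[C]_m) (phi : R) : 'M[C]_(m * n) :=
  expmx (- ('i * real_complex R phi) *: H) *t (1%:M : 'M[C]_n).

Definition evolve m n (H : 'M[C]_m) (rho : 'M[C]_(m * n)) (phi : R)
    : 'M[C]_(m * n) :=
  evolution n H phi *m rho *m (evolution n H phi) ^t*.

(* Self-adjointness of L is not imposed; by [qfiE] below it does not affect the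
   value of the Fisher information. *)
Definition is_sld d (f : R -> 'M[C]_d) (phi : R) (L : 'M[C]_d) : Prop :=
  2 *: mxderive f phi = L *m f phi + f phi *m L.

(* Quantum Fisher information of the family f at phi. When f phi is not of full
   rank the solution L is not unique, but tr (f phi L^2) is ([qfiE]). *)
Definition qfi d (f : R -> 'M[C]_d) (phi : R) : R :=
  let L := xget 0 [set L | is_sld f phi L] in
  complex.Re (\tr (f phi *m (L *m L))).

Lemma qfiE d (f : R -> 'M[C]_d) phi L : is_sld f phi L ->
  qfi f phi = complex.Re (\tr (f phi *m (L *m L))).
Proof.
rewrite /qfi => hL; case: xgetP => [L' _ /= hL'|/(_ L)]; last by [].
have E (X Y : 'M[C]_d) : is_sld f phi X -> is_sld f phi Y ->
    2 * \tr (f phi *m (X *m X)) =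
    \tr (f phi *m (X *m Y)) + \tr (f phi *m (Y *m X)).
  rewrite /is_sld => hX hY; have := hX; rewrite hY => /(congr1 (mulmx^~ X)).
  move=> /(congr1 mxtrace); rewrite !mulmxDl !mxtraceD.
  rewrite -!(mulmxA _ (f phi) X) (mxtrace_mulC Y) (mxtrace_mulC X (f phi *m X)).
  by rewrite -!mulmxA => ->; rewrite mulr2n mulrDl mul1r.
congr complex.Re; apply: (@mulfI _ (2 : C)); first by rewrite pnatr_eq0.
by rewrite (E _ _ hL' hL) (E _ _ hL hL') addrC.
Qed.

End Matrices.

(* A detection strategy on a d-dimensional system: a POVM, measured on each of
   nu independent copies, and for every nu an estimator of the parameter
   computed from the nu outcomes. *)
Record strategy (R : realType) (d : nat) := Strategy {
  outcome : finType;
  effect : outcome -> 'M[complex R]_d;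
  effect_psd : forall x, psdmx (effect x);
  effect_sum : \sum_x effect x = 1%:M;
  estimator : forall nu : nat, {ffun 'I_nu -> outcome} -> R }.

Section Estimation.
Variables (R : realType) (d : nat).
Implicit Types (s : strategy R d) (rho : 'M[complex R]_d).

(* Born rule. *)
Definition outcome_prob s rho (x : outcome s) : R :=
  complex.Re (\tr (effect x *m rho)).

Definition expectation_est s rho nu (g : R -> R) : R :=
  \sum_(x : {ffun 'I_nu -> outcome s})
    (\prod_(j < nu) outcome_prob rho (x j)) * g (estimator x).

Definition mean_est s rho nu : R := expectation_est s rho nu id.

Definition var_est s rho nu : R :=
  expectation_est s rho nu (fun t => (t - mean_est s rho nu) ^+ 2).

(* Unbiasedness at the true value phi, to first order: the expectation is phi at
   phi and has derivative 1 there. This is the notion of unbiasedness under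
   which the quantum Cramer-Rao bound holds; unbiasedness at all real phi is
   impossible for periodic families. *)
Definition locally_unbiased s (f : R -> 'M[complex R]_d) (phi : R) nu : Prop :=
  mean_est s (f phi) nu = phi /\
  is_derive phi (1 : R) (fun t => mean_est s (f t) nu) 1.

(* Var ~ 1 / (nu F) as nu tends to infinity. *)
Definition saturates_qcrb s (f : R -> 'M[complex R]_d) (phi : R) : Prop :=
  (fun nu : nat => var_est s (f phi) nu / (1 / (nu%:R * qfi f phi)))
    @ \oo --> (1 : R).

End Estimation.

(* Main.v *)
(** In an eigenbasis of [rho] with eigenvalues [p a], writing [K a b] for the
    entries of the generator, the skew information is
    [1/2 * sum (sqrt (p a) - sqrt (p b))^2 |K a b|^2] and the quantum Fisher
    information is [2 * sum (p a - p b)^2 / (p a + p b) |K a b|^2]; factoring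
    [p a - p b] gives [4 I <= F] term by term. The skew information is invariant
    along the evolution because the evolution operator commutes with [K].
    The minimum defining the local quantum uncertainty is attained by
    compactness of the unitary group; if it vanishes then [rho] commutes with
    some nondegenerate [K_A (x) 1], which makes [rho] block diagonal in the
    eigenbasis of [K_A], i.e. of zero discord. A saturating strategy measures
    the symmetric logarithmic derivative [L]: as [tr (rho L) = 0] and
    [tr (rho L^2) = F], the rescaled sample mean has variance [1 / (nu F)]. *)

Require Import Defs.
From HB Require Import structures.
From mathcomp Require Import all_boot all_order all_algebra.
From mathcomp Require Import all_classical all_reals all_analysis.
From mathcomp Require Import complex ring lra.
From mathcomp Require mxtens.
Import Order.TTheory GRing.Theory Num.Theory.
Import numFieldNormedType.Exports.
Local Open Scope classical_set_scope.
Local Open Scope ring_scope.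
Local Open Scope sesquilinear_scope.
Set Implicit Arguments.
Unset Strict Implicit.
Unset Printing Implicit Defensive.

(** * Scalars, adjoints and the spectral theorem *)

Section ComplexScalars.
Variable R : realType.
Local Notation C := (complex R).
Implicit Types z : C.

Definition sqnorm z : R := complex.Re z ^+ 2 + complex.Im z ^+ 2.

Lemma sqnorm_ge0 z : 0 <= sqnorm z.
Proof. by rewrite addr_ge0 // sqr_ge0. Qed.

Lemma mul_conj_sqnorm z : z * z^* = real_complex R (sqnorm z).
Proof. by rewrite -normCK -add_Re2_Im2. Qed.

Lemma ReM_real (a : R) z : complex.Re (real_complex R a * z) = a * complex.Re z.
Proof. by case: z => x y /=; rewrite mul0r subr0. Qed.

Lemma Re_sum (I : Type) (r : seq I) (P : pred I) (F : I -> C) :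
  complex.Re (\sum_(i <- r | P i) F i) = \sum_(i <- r | P i) complex.Re (F i).
Proof. exact: (raddf_sum (@complex.Re R : Rcomplex R -> R)). Qed.

Lemma Im_sum (I : Type) (r : seq I) (P : pred I) (F : I -> C) :
  complex.Im (\sum_(i <- r | P i) F i) = \sum_(i <- r | P i) complex.Im (F i).
Proof. exact: (raddf_sum (@complex.Im R : Rcomplex R -> R)). Qed.

Lemma sqnorm0_eq0 z : sqnorm z = 0 -> z = 0.
Proof.
move=> /(congr1 (real_complex R)); rewrite -mul_conj_sqnorm rmorph0 => /eqP.
by rewrite mulf_eq0 conjC_eq0 orbb => /eqP.
Qed.

Lemma conj_real_complex (a : R) : (real_complex R a)^* = real_complex R a.
Proof. by apply: CrealP; apply/complex_realP; exists a. Qed.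

Lemma sqrtC_real_complex (a : R) : 0 <= a ->
  sqrtC (real_complex R a) = real_complex R (Num.sqrt a).
Proof.
move=> a0; apply: (@pexpIrn _ 2) => //; rewrite ?nnegrE ?sqrtC_ge0 ?ler0c ?sqrtr_ge0 //.
by rewrite sqrtCK -rmorphXn /= sqr_sqrtr.
Qed.

End ComplexScalars.

Section Adjoint.
Variable R : realType.
Local Notation C := (complex R).

Lemma adjmxM m n p (A : 'M[C]_(m, n)) (B : 'M[C]_(n, p)) :
  (A *m B) ^t* = B ^t* *m A ^t*.
Proof. by rewrite trmx_mul map_mxM. Qed.

Lemma adjmxZ m n a (A : 'M[C]_(m, n)) : (a *: A) ^t* = a^* *: A ^t*.
Proof. by rewrite linearZ map_mxZ. Qed.

Lemma adjmx1 n : (1%:M : 'M[C]_n) ^t* = 1%:M.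
Proof. by rewrite trmx1 map_mx1. Qed.

Lemma adjmxE m n (A : 'M[C]_(m, n)) i j : (A ^t*) i j = (A j i)^*.
Proof. by rewrite !mxE. Qed.

Lemma mul_mx_diagE m n (A : 'M[C]_(m, n)) (d : 'rV_n) i j :
  (A *m diag_mx d) i j = A i j * d 0 j.
Proof. by rewrite mul_mx_diag mxE. Qed.

Lemma mul_diag_mxE m n (A : 'M[C]_(m, n)) (d : 'rV_m) i j :
  (diag_mx d *m A) i j = d 0 i * A i j.
Proof. by rewrite mul_diag_mx mxE. Qed.

Lemma adjmx_tens m n p q (A : 'M[C]_(m, n)) (B : 'M[C]_(p, q)) :
  (A *t B) ^t* = A ^t* *t B ^t*.
Proof. by rewrite mxtens.trmx_tens mxtens.map_mxT. Qed.

Lemma adjmx_diag_real n (p : 'rV[R]_n) :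
  (diag_mx (map_mx (real_complex R) p)) ^t* = diag_mx (map_mx (real_complex R) p).
Proof.
rewrite tr_diag_mx map_diag_mx; congr diag_mx; apply/rowP => i.
by rewrite !mxE; exact: conj_real_complex.
Qed.

Lemma mul_adj_unitary n (V : 'M[C]_n) : V \is unitarymx -> V ^t* *m V = 1%:M.
Proof. by move=> hV; rewrite -invmx_unitary // mulVmx // unitarymx_unit. Qed.

Lemma hermsymmxP n (A : 'M[C]_n) : A \is hermsymmx <-> A ^t* = A.
Proof.
split; first by move=> /is_hermitianmxP; rewrite expr0 scale1r => {2}->.
by move=> h; apply/is_hermitianmxP; rewrite expr0 scale1r h.
Qed.

Lemma hermitianE n (A : 'M[C]_n) i j : A ^t* = A -> A j i = (A i j)^*.
Proof. by move=> h; rewrite -{1}h adjmxE. Qed.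

Lemma conj_diag_adj n (V : 'M[C]_n) (Lam : 'rV[R]_n) :
  (conj_diag V Lam) ^t* = conj_diag V Lam.
Proof. by rewrite !adjmxM trmxCK adjmx_diag_real mulmxA. Qed.

Lemma conj_diag_mul n (U V : 'M[C]_n) (Lam : 'rV[R]_n) :
  U *m conj_diag V Lam *m U ^t* = conj_diag (U *m V) Lam.
Proof. by rewrite /conj_diag adjmxM !mulmxA. Qed.

Lemma conj_diagM n (V : 'M[C]_n) (p q : 'rV[R]_n) : V \is unitarymx ->
  conj_diag V p *m conj_diag V q = conj_diag V (\row_i (p 0 i * q 0 i)).
Proof.
move=> hV; rewrite /conj_diag !mulmxA.
rewrite -(mulmxA (V *m _)) mul_adj_unitary // mulmx1 -(mulmxA V) mulmx_diag.
by congr (_ *m diag_mx _ *m _); apply/rowP => i; rewrite !mxE rmorphM.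
Qed.

Lemma mxtrace_unitary_conj n (V A : 'M[C]_n) : V \is unitarymx ->
  \tr (V *m A *m V ^t*) = \tr A.
Proof. by move=> hV; rewrite mxtrace_mulC mulmxA mul_adj_unitary // mul1mx. Qed.

Lemma tens11 m n : (1%:M : 'M[C]_m) *t (1%:M : 'M[C]_n) = 1%:M.
Proof.
apply/matrixP => i j.
case: (mxtens.mxtens_indexP i) => i0 i1; case: (mxtens.mxtens_indexP j) => j0 j1.
rewrite mxtens.tensmxE !mxE (can_eq (@mxtens.mxtens_indexK _ _)) xpair_eqE.
by case: (i0 == j0); case: (i1 == j1); rewrite ?mulr1n ?mulr0n ?mulr1 ?mulr0 ?mul0r.
Qed.

Lemma tens1_unitary m n (V : 'M[C]_m) : V \is unitarymx ->
  V *t (1%:M : 'M[C]_n) \is unitarymx.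
Proof.
move=> /unitarymxP hV; apply/unitarymxP.
by rewrite adjmx_tens adjmx1 mxtens.tensmx_mul mulmx1 hV tens11.
Qed.

(* The row of eigenvalues of [diag_mx D *t 1], in the row-major indexing of [*t]. *)
Definition tens_row m n (T : Type) (D : 'rV[T]_m) : 'rV[T]_(m * n) :=
  \row_k D 0 (mxtens.mxtens_unindex k).1.

Lemma diag_mx_tens1 m n (D : 'rV[C]_m) :
  diag_mx D *t (1%:M : 'M[C]_n) = diag_mx (tens_row n D).
Proof.
apply/matrixP => i j.
case: (mxtens.mxtens_indexP i) => i0 i1; case: (mxtens.mxtens_indexP j) => j0 j1.
rewrite mxtens.tensmxE !mxE mxtens.mxtens_indexK /=.
rewrite (can_eq (@mxtens.mxtens_indexK _ _)) xpair_eqE.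
by case: (i0 == j0); case: (i1 == j1); rewrite ?mulr1n ?mulr0n ?mulr1 ?mulr0 ?mul0r.
Qed.

Lemma conj_diag_tens1 m n (V : 'M[C]_m) (Lam : 'rV[R]_m) :
  conj_diag V Lam *t (1%:M : 'M[C]_n) =
  conj_diag (V *t (1%:M : 'M[C]_n)) (tens_row n Lam).
Proof.
rewrite /conj_diag adjmx_tens adjmx1 (_ : map_mx _ (tens_row n Lam) =
  tens_row n (map_mx (real_complex R) Lam)); last by apply/rowP => k; rewrite !mxE.
by rewrite -diag_mx_tens1 !mxtens.tensmx_mul !mulmx1.
Qed.

End Adjoint.

(** * Diagonalization of Hermitian matrices with real eigenvalues, and square roots *)

Section SpectralCalculus.
Variable R : realType.
Local Notation C := (complex R).

Lemma hermitian_conj_diag n (A : 'M[C]_n) : A ^t* = A ->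
  exists2 V : 'M[C]_n, V \is unitarymx & exists p : 'rV[R]_n, A = conj_diag V p.
Proof.
move=> /hermsymmxP hA; have /orthomx_spectralP := hermitian_normalmx hA.
have := hermitian_spectral_diag_real hA; have := spectral_unitarymx A.
move: (spectralmx A) (spectral_diag A) => P s hP /mxOverP hs.
rewrite invmx_unitary // => ->; exists (P ^t*); first by rewrite trmxC_unitary.
exists (map_mx (@complex.Re R) s); rewrite /conj_diag trmxCK.
congr (_ *m diag_mx _ *m _); apply/rowP => i; rewrite mxE mxE.
by rewrite RRe_real.
Qed.

(** In the coordinates [V ^t* *m x] the quadratic form is a sum of [p i] times squared moduli; the
    i-th column of [V] as test vector isolates [p i]. *)
Lemma psd_conj_diag_ge0 n (V : 'M[C]_n) (p : 'rV[R]_n) : V \is unitarymx ->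
  psdmx (conj_diag V p) <-> forall i, 0 <= p 0 i.
Proof.
move=> hV; have E (x : 'cV[C]_n) : (x ^t* *m conj_diag V p *m x) 0 0 =
    \sum_i real_complex R (p 0 i) * real_complex R (sqnorm ((V ^t* *m x) i 0)).
  have -> : x ^t* *m conj_diag V p *m x = (V ^t* *m x) ^t* *m
      (diag_mx (map_mx (real_complex R) p) *m (V ^t* *m x)).
    by rewrite adjmxM trmxCK /conj_diag !mulmxA.
  rewrite mxE; apply: eq_bigr => i _.
  rewrite adjmxE mul_diag_mxE [map_mx _ _ _ _]mxE -mul_conj_sqnorm mulrCA.
  by congr (_ * _); rewrite mulrC.
split=> [[_ h] i|h].
  have := h (V *m delta_mx i 0); rewrite E mulmxA mul_adj_unitary // mul1mx.
  rewrite (bigD1 i) //= big1 => [|j ji]; rewrite -mul_conj_sqnorm !mxE.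
    by rewrite !eqxx conjC1 !mulr1 addr0 ler0c.
  by rewrite (negPf ji) mul0r mulr0.
split=> [|x]; first by apply/hermsymmxP; rewrite conj_diag_adj.
by rewrite E sumr_ge0 // => i _; rewrite -rmorphM /= ler0c mulr_ge0 // sqnorm_ge0.
Qed.

Lemma psd_conj_diag n (A : 'M[C]_n) : psdmx A ->
  exists2 V : 'M[C]_n, V \is unitarymx &
  exists2 p : 'rV[R]_n, (forall i, 0 <= p 0 i) & A = conj_diag V p.
Proof.
move=> hA; have [V hV [p eA]] := hermitian_conj_diag (iffLR (hermsymmxP _) hA.1).
exists V => //; exists p => //; rewrite eA in hA; exact: (iffLR (psd_conj_diag_ge0 p hV)).
Qed.

(* Both diagonalizations of the same matrix are intertwined by the unitary
   [X = spectralmx A *m V]; wherever [X i j] is nonzero the eigenvalues agree,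
   so any function of them does too. *)
Lemma sqrtmx_conj_diag n (V : 'M[C]_n) (p : 'rV[R]_n) : V \is unitarymx ->
  (forall i, 0 <= p 0 i) -> sqrtmx (conj_diag V p) = conj_diag V (map_mx Num.sqrt p).
Proof.
move=> hV p0; set A := conj_diag V p.
have hA : A \is hermsymmx by apply/hermsymmxP; rewrite conj_diag_adj.
have /orthomx_spectralP := hermitian_normalmx hA.
have hP := spectral_unitarymx A; rewrite /sqrtmx.
move: (spectralmx A) (spectral_diag A) hP => P s hP; rewrite invmx_unitary // => eA.
pose X := P *m V.
have eX : X *m diag_mx (map_mx (real_complex R) p) = diag_mx s *m X.
  have /(congr1 (fun M => P *m M *m V)) := eA.
  rewrite /A /conj_diag !mulmxA (unitarymxP hP) mul1mx.
  by rewrite -(mulmxA _ (V ^t*)) mul_adj_unitary // mulmx1 -!mulmxA.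
have eS : X *m diag_mx (map_mx (real_complex R) (map_mx Num.sqrt p)) =
    diag_mx (map_mx sqrtC s) *m X.
  apply/matrixP => i j; move/matrixP/(_ i j): eX.
  rewrite !mul_mx_diagE !mul_diag_mxE ![map_mx _ _ _ _]mxE.
  have [-> _|x0] := eqVneq (X i j) 0; first by rewrite mul0r mulr0.
  by rewrite mulrC => /(mulIf x0) <-; rewrite sqrtC_real_complex // mulrC.
have eV : V = P ^t* *m X by rewrite /X mulmxA mul_adj_unitary // mul1mx.
rewrite /conj_diag {1}eV -(mulmxA _ X) eS /X !mulmxA.
by rewrite -(mulmxA _ V) (unitarymxP hV) mulmx1.
Qed.

End SpectralCalculus.

(** * Skew information and Fisher information in an eigenbasis *)

Section Entries.
Variable T : pzRingType.

Lemma addmxE m n (A B : 'M[T]_(m, n)) i j : (A + B) i j = A i j + B i j.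
Proof. by rewrite mxE. Qed.

Lemma submxE m n (A B : 'M[T]_(m, n)) i j : (A - B) i j = A i j - B i j.
Proof. by rewrite !mxE. Qed.

Lemma scalemxE m n a (A : 'M[T]_(m, n)) i j : (a *: A) i j = a * A i j.
Proof. by rewrite mxE. Qed.

End Entries.

Section EigenbasisFormulas.
Variable R : realType.
Local Notation C := (complex R).
Variables (d : nat) (V K : 'M[C]_d) (p : 'rV[R]_d).
Hypotheses (hV : V \is unitarymx) (p0 : forall i, 0 <= p 0 i) (hK : K ^t* = K).

Let k := V ^t* *m K *m V.
Let D (q : 'rV[R]_d) := diag_mx (map_mx (real_complex R) q).

Lemma unitary_conjM (A B : 'M[C]_d) :
  (V *m A *m V ^t*) *m (V *m B *m V ^t*) = V *m (A *m B) *m V ^t*.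
Proof. by rewrite !mulmxA -(mulmxA (V *m A)) mul_adj_unitary // mulmx1. Qed.

Lemma unitary_conjB (A B : 'M[C]_d) :
  V *m A *m V ^t* - V *m B *m V ^t* = V *m (A - B) *m V ^t*.
Proof. by rewrite mulmxBr mulmxBl. Qed.

Lemma unitary_conjD (A B : 'M[C]_d) :
  V *m A *m V ^t* + V *m B *m V ^t* = V *m (A + B) *m V ^t*.
Proof. by rewrite mulmxDr mulmxDl. Qed.

Lemma unitary_conj_adj (A : 'M[C]_d) : (V *m A *m V ^t*) ^t* = V *m A ^t* *m V ^t*.
Proof. by rewrite !adjmxM trmxCK mulmxA. Qed.

Let eK : K = V *m k *m V ^t*.
Proof. by rewrite /k !mulmxA (unitarymxP hV) mul1mx -mulmxA (unitarymxP hV) mulmx1. Qed.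

Lemma eigenbasis_herm a b : k b a = (k a b)^*.
Proof. by apply: hermitianE; rewrite /k !adjmxM trmxCK hK mulmxA. Qed.

Lemma sqnorm_eigenbasisC a b : sqnorm (k b a) = sqnorm (k a b).
Proof. by rewrite eigenbasis_herm; case: (k a b) => x y; rewrite /sqnorm /= sqrrN. Qed.

(** In the eigenbasis the commutator has entries [(q a - q b) * k a b] with [q] the square roots of
    [p]. The trace of its square pairs the entry (a, b) with (b, a), and the antisymmetry of
    [q a - q b] cancels the minus sign of the definition. *)
Lemma skew_info_eigenbasis : skew_info (conj_diag V p) K =
  2^-1 * \sum_a \sum_b (Num.sqrt (p 0 a) - Num.sqrt (p 0 b)) ^+ 2 * sqnorm (k a b).
Proof.
rewrite /skew_info sqrtmx_conj_diag //; set q := map_mx Num.sqrt p.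
have -> : conj_diag V q *m K - K *m conj_diag V q =
    V *m (D q *m k - k *m D q) *m V ^t*.
  by rewrite eK /conj_diag !unitary_conjM unitary_conjB.
rewrite unitary_conjM mxtrace_unitary_conj //; set M := _ - _.
have eM a b : M a b = real_complex R (q 0 a - q 0 b) * k a b.
  rewrite /M submxE mul_diag_mxE mul_mx_diagE ![map_mx (real_complex R) _ _ _]mxE.
  by rewrite rmorphB mulrBl (mulrC (k a b)).
have -> : \tr (M *m M) = real_complex R
    (- \sum_a \sum_b (q 0 a - q 0 b) ^+ 2 * sqnorm (k a b)).
  rewrite /mxtrace rmorphN rmorph_sum -sumrN; apply: eq_bigr => a _.
  rewrite mxE rmorph_sum -sumrN; apply: eq_bigr => b _; rewrite !eM.
  rewrite (eigenbasis_herm a b) rmorphM /= -mul_conj_sqnorm -(opprB (q 0 a)) rmorphN rmorphXn /=.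
  by rewrite expr2; ring.
have -> : (- 2^-1 : C) = real_complex R (- 2^-1) by rewrite rmorphN fmorphV rmorph_nat.
rewrite -rmorphM /= mulrNN; congr (_ * _); apply: eq_bigr => a _; apply: eq_bigr => b _.
by rewrite !mxE.
Qed.

(* At [p a = p b = 0] the quotient is [0 / 0 = 0], which is a valid choice
   for the corresponding entry of the logarithmic derivative. *)
Let g a b : R := (p 0 a - p 0 b) / (p 0 a + p 0 b).

(** The logarithmic derivative written in the eigenbasis: entrywise its equation reads [(p a + p b)
    * l a b = 2 * 'i * (p a - p b) * k a b]. *)
Let l : 'M[C]_d := \matrix_(a, b) ('i * real_complex R (2 * g a b) * k a b).

Let lE a b : l a b = 'i * real_complex R (2 * g a b) * k a b.
Proof. by rewrite mxE. Qed.

Definition eigenbasis_sld : 'M[C]_d := V *m l *m V ^t*.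

Let gC a b : g b a = - g a b.
Proof. by rewrite /g -(opprB (p 0 a)) mulNr (addrC (p 0 b)). Qed.

(** The degenerate case is harmless: nonnegative eigenvalues with zero sum both vanish, hence so
    does their difference. *)
Let gM a b : g a b * (p 0 a + p 0 b) = p 0 a - p 0 b.
Proof.
rewrite /g; have [e|h] := eqVneq (p 0 a + p 0 b) 0; last by rewrite divfK.
have /andP[/eqP -> /eqP ->] : (p 0 a == 0) && (p 0 b == 0).
  by rewrite -paddr_eq0 // e.
by rewrite subrr addr0 mulr0.
Qed.

(** Exchanging the indices flips the sign of [g], conjugation flips the sign of ['i], and the two
    signs cancel. *)
Lemma eigenbasis_sld_adj : eigenbasis_sld ^t* = eigenbasis_sld.
Proof.
rewrite /eigenbasis_sld unitary_conj_adj; suff -> : l ^t* = l by [].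
apply/matrixP => a b; rewrite adjmxE !lE (rmorphM Num.conj) (rmorphM Num.conj) /=.
rewrite conjCi conj_real_complex -(eigenbasis_herm b a) (gC a b) mulrN rmorphN.
by rewrite mulrNN.
Qed.

(** The left-hand side is twice the derivative of the state under the evolution generated by [K], so
    this is the defining equation of the logarithmic derivative. *)
Lemma eigenbasis_sldP :
  2 *: (- 'i *: (K *m conj_diag V p - conj_diag V p *m K)) =
  eigenbasis_sld *m conj_diag V p + conj_diag V p *m eigenbasis_sld.
Proof.
have -> : K *m conj_diag V p - conj_diag V p *m K = V *m (k *m D p - D p *m k) *m V ^t*.
  by rewrite eK /conj_diag !unitary_conjM unitary_conjB.
rewrite /eigenbasis_sld /conj_diag -/(D p) !unitary_conjM unitary_conjD scalerA.
rewrite scalemxAl scalemxAr.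
suff -> : (2 * - 'i) *: (k *m D p - D p *m k) = l *m D p + D p *m l by [].
apply/matrixP => a b; rewrite scalemxE submxE addmxE !mul_mx_diagE !mul_diag_mxE !lE.
rewrite ![map_mx _ _ _ _]mxE rmorphM /= rmorph_nat.
transitivity ('i * 2 * k a b * real_complex R (p 0 a - p 0 b)).
  by rewrite rmorphB /=; ring.
by rewrite -gM rmorphM rmorphD /=; ring.
Qed.

(** Only the diagonal of [l] enters, and it is zero because [g a a = 0]. This centers the
    measurement outcomes of the optimal strategy. *)
Lemma eigenbasis_sld_trace0 : \tr (conj_diag V p *m eigenbasis_sld) = 0.
Proof.
rewrite /eigenbasis_sld /conj_diag unitary_conjM mxtrace_unitary_conj //.
rewrite /mxtrace big1 // => a _; rewrite mul_diag_mxE lE.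
by rewrite /g subrr mul0r mulr0 rmorph0 mulr0 mul0r mulr0.
Qed.

Lemma eigenbasis_fisher :
  \tr (conj_diag V p *m (eigenbasis_sld *m eigenbasis_sld)) = real_complex R
  (2 * \sum_a \sum_b (p 0 a - p 0 b) ^+ 2 / (p 0 a + p 0 b) * sqnorm (k a b)).
Proof.
pose T := \sum_a \sum_b p 0 a * (4 * g a b ^+ 2 * sqnorm (k a b)).
have lM a b : l a b * l b a = real_complex R (4 * g a b ^+ 2 * sqnorm (k a b)).
  rewrite !lE (eigenbasis_herm a b) (gC a b) (rmorphM (real_complex R) _ (sqnorm _)).
  rewrite /= -mul_conj_sqnorm mulrN rmorphN (_ : 4 * g a b ^+ 2 = (2 * g a b) ^+ 2); last by ring.
  have i2 : 'i * 'i = -1 :> C by rewrite -expr2 sqrCi.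
  rewrite rmorphXn /=; transitivity
    (- ('i * 'i) * real_complex R (2 * g a b) ^+ 2 * (k a b * (k a b)^* )); first by ring.
  by rewrite i2 opprK mul1r.
have -> : \tr (conj_diag V p *m (eigenbasis_sld *m eigenbasis_sld)) = real_complex R T.
  rewrite /eigenbasis_sld /conj_diag !unitary_conjM mxtrace_unitary_conj //.
  rewrite /mxtrace rmorph_sum; apply: eq_bigr => a _; rewrite mul_diag_mxE.
  rewrite [map_mx _ _ _ _]mxE [X in _ * X]mxE rmorph_sum mulr_sumr.
  by apply: eq_bigr => b _; rewrite lM -rmorphM.
congr (real_complex R _).
(* Adding [T] to itself with the indices exchanged replaces the weight [p a] by [p a + p b], which
   cancels one of the two denominators in [g a b ^+ 2]. *)
have T2 : T + T = \sum_a \sum_b 4 * ((p 0 a - p 0 b) ^+ 2 / (p 0 a + p 0 b) * sqnorm (k a b)).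
  rewrite {2}/T exchange_big -big_split; apply: eq_bigr => a _ /=.
  rewrite -big_split; apply: eq_bigr => b _ /=.
  rewrite (sqnorm_eigenbasisC a b) (gC a b) sqrrN.
  have -> : (p 0 a - p 0 b) ^+ 2 / (p 0 a + p 0 b) = g a b ^+ 2 * (p 0 a + p 0 b).
    by rewrite expr2 [in RHS]expr2 -(mulrA (g a b)) gM {1}/g; ring.
  by ring.
apply: (@mulfI _ 2); first by rewrite pnatr_eq0.
rewrite mulr2n mulrDl mul1r T2 mulrA mulr_sumr; apply: eq_bigr => a _.
rewrite mulr_sumr; apply: eq_bigr => b _.
by congr (_ * _); ring.
Qed.

(** The terms compare because [p a + p b] is at most the square of [sqrt (p a) + sqrt (p b)], the
    cross term being nonnegative. Where [p a + p b = 0] both terms are zero. *)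
Lemma skew_info_le_fisher_eigenbasis : 4 * skew_info (conj_diag V p) K <=
  complex.Re (\tr (conj_diag V p *m (eigenbasis_sld *m eigenbasis_sld))).
Proof.
rewrite skew_info_eigenbasis eigenbasis_fisher /= mulrA.
have -> : 4 * 2^-1 = 2 :> R by field.
rewrite ler_pM2l // ler_sum // => a _; apply: ler_sum => b _.
apply: ler_wpM2r; first exact: sqnorm_ge0.
have sa := sqr_sqrtr (p0 a); have sb := sqr_sqrtr (p0 b).
have [e|h] := eqVneq (p 0 a + p 0 b) 0.
  have /andP[/eqP -> /eqP ->] : (p 0 a == 0) && (p 0 b == 0) by rewrite -paddr_eq0 // e.
  by rewrite !subrr expr0n mul0r.
rewrite ler_pdivlMr; last by rewrite lt_def h addr_ge0.
have -> : p 0 a - p 0 b =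
    (Num.sqrt (p 0 a) - Num.sqrt (p 0 b)) * (Num.sqrt (p 0 a) + Num.sqrt (p 0 b)).
  by rewrite -subr_sqr sa sb.
rewrite exprMn; apply: ler_wpM2l; first exact: sqr_ge0.
rewrite -{1}sa -{1}sb sqrrD addrAC lerDl mulrn_wge0 // mulr_ge0 ?sqrtr_ge0 //.
Qed.

End EigenbasisFormulas.

(** * Complex derivatives and the matrix exponential *)

Section ComplexDerivative.
Variable R : realType.
Local Notation C := (complex R).
Implicit Types f g : R -> C.

(** Splitting into real and imaginary parts matches the encoding of [mxderive] and keeps all
    differentiation over the reals. *)
Definition is_cderive f (t : R) (l : C) : Prop :=
  is_derive t (1 : R) (fun s => complex.Re (f s)) (complex.Re l) /\
  is_derive t (1 : R) (fun s => complex.Im (f s)) (complex.Im l).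

Lemma is_cderive_cst (c : C) t : is_cderive (fun=> c) t 0.
Proof. by split; exact: is_derive_cst. Qed.

Lemma is_cderiveD f g t a b : is_cderive f t a -> is_cderive g t b ->
  is_cderive (fun s => f s + g s) t (a + b).
Proof.
move=> [f1 f2] [g1 g2]; split.
- have -> : (fun s => complex.Re (f s + g s)) =
    (fun s => complex.Re (f s)) + (fun s => complex.Re (g s)).
    by apply/funext => s; rewrite /GRing.add /=; case: (f s); case: (g s).
  by apply: is_derive_eq; case: (a); case: (b).
- have -> : (fun s => complex.Im (f s + g s)) =
    (fun s => complex.Im (f s)) + (fun s => complex.Im (g s)).
    by apply/funext => s; rewrite /GRing.add /=; case: (f s); case: (g s).
  by apply: is_derive_eq; case: (a); case: (b).
Qed.

Lemma is_cderiveM f g t a b : is_cderive f t a -> is_cderive g t b ->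
  is_cderive (fun s => f s * g s) t (a * g t + f t * b).
Proof.
move=> [f1 f2] [g1 g2]; split.
- have -> : (fun s => complex.Re (f s * g s)) =
    (fun s => complex.Re (f s)) * (fun s => complex.Re (g s)) -
    (fun s => complex.Im (f s)) * (fun s => complex.Im (g s)).
    by apply/funext => s; rewrite /GRing.mul /GRing.add /GRing.opp /=; case: (f s); case: (g s).
  apply: is_derive_eq; rewrite /GRing.scale /=.
  by case: (a) (b) (f t) (g t) => ? ? [? ?] [? ?] [? ?] /=; ring.
- have -> : (fun s => complex.Im (f s * g s)) =
    (fun s => complex.Re (f s)) * (fun s => complex.Im (g s)) +
    (fun s => complex.Im (f s)) * (fun s => complex.Re (g s)).
    by apply/funext => s; rewrite /GRing.mul /GRing.add /=; case: (f s); case: (g s).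
  apply: is_derive_eq; rewrite /GRing.scale /=.
  by case: (a) (b) (f t) (g t) => ? ? [? ?] [? ?] [? ?] /=; ring.
Qed.

Lemma is_cderive_sum (I : Type) (r : seq I) (F : I -> R -> C) (t : R) (a : I -> C) :
  (forall i, is_cderive (F i) t (a i)) ->
  is_cderive (fun s => \sum_(i <- r) F i s) t (\sum_(i <- r) a i).
Proof.
move=> h; elim: r => [|i r IH].
  rewrite big_nil (_ : (fun s => _) = (fun=> 0)); first exact: is_cderive_cst.
  by apply/funext => s; rewrite big_nil.
rewrite big_cons (_ : (fun s => _) = (fun s => F i s + \sum_(j <- r) F j s)).
  exact: is_cderiveD.
by apply/funext => s; rewrite big_cons.
Qed.

Lemma is_cderive_conj f t a : is_cderive f t a -> is_cderive (fun s => (f s)^*) t a^*.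
Proof.
move=> [f1 f2]; split.
- have -> : (fun s => complex.Re ((f s)^*)) = (fun s => complex.Re (f s)).
    by apply/funext => s; case: (f s).
  by case: (a) f1.
- have -> : (fun s => complex.Im ((f s)^*)) = - (fun s => complex.Im (f s)).
    by apply/funext => s; rewrite /GRing.opp /=; case: (f s).
  by apply: is_derive_eq; case: (a).
Qed.

(** The unit complex number $e^{it}$. *)
Definition phase (t : R) : C := Complex (cos t) (sin t).

Lemma mul_phase_conj t : phase t * (phase t)^* = 1.
Proof. by rewrite mul_conj_sqnorm /sqnorm /= cos2Dsin2. Qed.

Lemma phase_derive (x t : R) :
  is_cderive (fun s => phase (- (s * x))) t (- 'i * real_complex R x * phase (- (t * x))).
Proof.
have hd : is_derive t (1 : R) (fun s : R => - (s * x)) (- x).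
  have -> : (fun s : R => - (s * x)) = - (x \*: (id : R -> R)).
    by apply/funext => s; rewrite /GRing.opp /= /GRing.scale /= mulrC.
  by apply: is_derive_eq; rewrite /GRing.scale /= mulr1.
have -> : - 'i * real_complex R x * phase (- (t * x)) =
    Complex (x * sin (- (t * x))) (- x * cos (- (t * x))).
  by rewrite -complexiE /=; congr Complex; ring.
split => /=.
- have /= := @is_derive1_comp R cos (fun s => - (s * x)) t _ _ (is_derive_cos _) hd.
  by move=> h; apply: is_derive_eq; rewrite /GRing.scale /=; ring.
- have /= := @is_derive1_comp R sin (fun s => - (s * x)) t _ _ (is_derive_sin _) hd.
  by move=> h; apply: is_derive_eq; rewrite /GRing.scale /=; ring.
Qed.

Definition is_mxderive m n (f : R -> 'M[C]_(m, n)) (t : R) (D : 'M[C]_(m, n)) : Prop :=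
  forall i j, is_cderive (fun s => f s i j) t (D i j).

Lemma mxderive_val d (f : R -> 'M[C]_d) t D : is_mxderive f t D -> mxderive f t = D.
Proof.
move=> h; apply/matrixP => i j; rewrite mxE !derive1E.
by have [/@derive_val -> /@derive_val ->] := h i j; case: (D i j).
Qed.

Lemma is_mxderive_cst m n (A : 'M[C]_(m, n)) t : is_mxderive (fun=> A) t 0.
Proof. by move=> i j; rewrite mxE; exact: is_cderive_cst. Qed.

Lemma is_mxderiveM m n p (f : R -> 'M[C]_(m, n)) (g : R -> 'M[C]_(n, p)) t D E :
  is_mxderive f t D -> is_mxderive g t E ->
  is_mxderive (fun s => f s *m g s) t (D *m g t + f t *m E).
Proof.
move=> hf hg i j; rewrite mxE ![(_ *m _) _ _]mxE -big_split /=.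
have -> : (fun s => (f s *m g s) i j) = (fun s => \sum_k f s i k * g s k j).
  by apply/funext => s; rewrite mxE.
by apply: is_cderive_sum => k; exact: is_cderiveM.
Qed.

Lemma is_mxderive_adj m n (f : R -> 'M[C]_(m, n)) t D :
  is_mxderive f t D -> is_mxderive (fun s => (f s) ^t*) t (D ^t*).
Proof.
move=> h i j; rewrite adjmxE.
have -> : (fun s => ((f s) ^t*) i j) = (fun s => (f s j i)^* ).
  by apply/funext => s; rewrite adjmxE.
exact: is_cderive_conj.
Qed.

End ComplexDerivative.

(** * The exponential series of a diagonalized Hermitian generator *)

Section MatrixExponential.
Variable R : realType.
Local Notation C := (complex R).

Lemma norm_real_complex (x : R) : `|real_complex R x| = real_complex R `|x|.
Proof. by rewrite normc_def /= expr0n addr0 sqrtr_sqr. Qed.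

Lemma normc_le_ReIm (z : C) :
  `|z| <= real_complex R (`|complex.Re z| + `|complex.Im z|).
Proof.
rewrite {1}[z]complexE; apply: le_trans (ler_normD _ _) _.
by rewrite normrM complexiE normCi mul1r !norm_real_complex -rmorphD.
Qed.

Lemma limn_mx (K : numFieldType) m n (F : nat -> 'M[K]_(m, n)) (M : 'M[K]_(m, n)) :
  (forall e : K, 0 < e -> \forall k \near \oo, forall i j, `|(M - F k) i j| < e) ->
  limn F = M.
Proof.
move=> h; apply/cvg_lim; first exact: norm_hausdorff.
apply/cvgrPdist_lt => e e0; apply: filterS (h e e0) => k hk; rewrite /Num.norm /= mx_normE.
(* The matrix norm is a maximum of entry norms taken among nonnegative elements, so [e] is lifted
   there before comparing. *)
move: e0 hk => /[dup] /ltW/nonnegP[{}e] e0 hk.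
rewrite num_lt; apply/bigmax_ltP; rewrite -num_lt /=; split => // -[i j] _.
exact: hk.
Qed.

Lemma near_mx_ReIm m n (F : nat -> 'M[C]_(m, n)) (M : 'M[C]_(m, n)) :
  (forall i j, (fun k => complex.Re (F k i j)) @ \oo --> complex.Re (M i j)) ->
  (forall i j, (fun k => complex.Im (F k i j)) @ \oo --> complex.Im (M i j)) ->
  forall e : C, 0 < e -> \forall k \near \oo, forall i j, `|(M - F k) i j| < e.
Proof.
move=> hR hI e e0.
(* A positive complex number is real, so the tolerance can be halved between the real and the
   imaginary part. *)
have [r r0 er] : exists2 r : R, 0 < r & e = real_complex R r.
  exists (complex.Re e); first by move: e0; rewrite ltcE => /andP[].
  by rewrite RRe_real // gtr0_real.
have r2 : 0 < r / 2 by rewrite divr_gt0.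
apply: filter_forall => i; apply: filter_forall => j; near=> k.
rewrite submxE; apply: le_lt_trans (normc_le_ReIm _) _; rewrite er ltcR (splitr r).
have -> : complex.Re (M i j - F k i j) = complex.Re (M i j) - complex.Re (F k i j).
  by case: (M i j); case: (F k i j).
have -> : complex.Im (M i j - F k i j) = complex.Im (M i j) - complex.Im (F k i j).
  by case: (M i j); case: (F k i j).
apply: ltrD; near: k.
  by have /cvgrPdist_lt := hR i j; apply.
by have /cvgrPdist_lt := hI i j; apply.
Unshelve. all: by end_near. Qed.

Lemma exp_coeff_phase (t : R) k :
  (k`!%:R : C)^-1 * ('i * real_complex R t) ^+ k = Complex (cos_coeff t k) (sin_coeff t k).
Proof.
(* Powers of ['i] are sorted by parity in the form used by [cos_coeff] and [sin_coeff]; the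
   truncated [k.-1] at [k = 0] is annihilated by the factor [odd k]. *)
have ei : ('i : C) ^+ k = Complex ((~~ odd k)%:R * (-1) ^+ k./2) ((odd k)%:R * (-1) ^+ k.-1./2).
  rewrite -{1}(odd_double_half k); case ok: (odd k) => /=.
    rewrite add1n exprS -mul2n exprM sqrCi -complexiE.
    have -> : (k.-1./2 = k./2)%N by rewrite -{1}(odd_double_half k) ok add1n /= doubleK.
    have -> : (-1 : C) = real_complex R (-1) by rewrite rmorphN1.
    rewrite -rmorphXn /=; congr Complex; ring.
  rewrite add0n -mul2n exprM sqrCi mul1r mul0r.
  have -> : (-1 : C) = real_complex R (-1) by rewrite rmorphN1.
  by rewrite -rmorphXn.
have -> : (k`!%:R : C)^-1 = real_complex R (k`!%:R)^-1 by rewrite fmorphV rmorph_nat.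
rewrite exprMn ei -rmorphXn /= /cos_coeff /sin_coeff /= -exprnP -!complexr0.
have mulE (a b c d : R) :
    Complex a b * Complex c d = Complex (a * c - b * d) (a * d + b * c) by [].
by rewrite !mulE; congr Complex; ring.
Qed.

Lemma series_exp_phase (t : R) N :
  \sum_(0 <= k < N) (k`!%:R : C)^-1 * ('i * real_complex R t) ^+ k =
  Complex (series (cos_coeff t) N) (series (sin_coeff t) N).
Proof.
under eq_bigr do rewrite exp_coeff_phase.
elim: N => [|N IH]; first by rewrite /series /= !big_geq.
by rewrite /series /= !big_nat_recr //= IH.
Qed.

(** Powers act on the diagonal factor alone, so each entry of a partial sum is a fixed linear
    combination of partial sums of scalar cosine and sine series. The limit is then taken entry by
    entry. *)
Lemma expmx_conj_diag m (V : 'M[C]_m) (Lam : 'rV[R]_m) (phi : R) : V \is unitarymx ->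
  expmx (- ('i * real_complex R phi) *: conj_diag V Lam) =
  V *m diag_mx (\row_k phase (- (phi * Lam 0 k))) *m V ^t*.
Proof.
move=> hV; pose z a := 'i * real_complex R (- (phi * Lam 0 a)).
pose Z k := diag_mx (\row_a z a ^+ k).
have eA1 : - ('i * real_complex R phi) *: conj_diag V Lam = V *m Z 1%N *m V ^t*.
  rewrite /conj_diag scalemxAl scalemxAr.
  suff -> : - ('i * real_complex R phi) *: diag_mx (map_mx (real_complex R) Lam) = Z 1%N by [].
  rewrite -linearZ /=; congr diag_mx; apply/rowP => a; rewrite scalemxE !mxE expr1 /z.
  by rewrite rmorphN rmorphM /=; ring.
have eA k : (- ('i * real_complex R phi) *: conj_diag V Lam) ^+ k = V *m Z k *m V ^t*.
  elim: k => [|k IH].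
    rewrite expr0 (_ : Z 0%N = 1%:M) ?mulmx1 ?(unitarymxP hV) //.
    by rewrite -diag_const_mx; congr diag_mx; apply/rowP => a; rewrite !mxE.
  rewrite exprS IH eA1 -mulmxE unitary_conjM //.
  rewrite /Z mulmx_diag.
  suff -> : (\row_i ((\row_a z a ^+ 1) 0 i * (\row_a z a ^+ k) 0 i)) = \row_a z a ^+ k.+1 by [].
  by apply/rowP => a; rewrite !mxE expr1 -exprS.
pose c i j a := V i a * (V j a)^*.
have eE (w : 'rV[C]_m) i j : (V *m diag_mx w *m V ^t*) i j = \sum_a c i j a * w 0 a.
  rewrite mxE; apply: eq_bigr => a _; rewrite mul_mx_diagE adjmxE /c; ring.
pose S N a : C := Complex (series (cos_coeff (- (phi * Lam 0 a))) N)
  (series (sin_coeff (- (phi * Lam 0 a))) N).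
have eS N i j : series (fun k : nat => (k`!%:R : C)^-1 *:
    (- ('i * real_complex R phi) *: conj_diag V Lam) ^+ k) N i j = \sum_a c i j a * S N a.
  rewrite /series /= summxE.
  have eT k : ((k`!%:R : C)^-1 *: (- ('i * real_complex R phi) *: conj_diag V Lam) ^+ k) i j =
      \sum_a (k`!%:R : C)^-1 * (c i j a * (\row_a z a ^+ k) 0 a).
    by rewrite scalemxE -mulr_sumr -eE -/(Z k) -eA.
  transitivity (\sum_(0 <= k < N) \sum_a (k`!%:R : C)^-1 * (c i j a * (\row_a z a ^+ k) 0 a)).
    by apply: eq_bigr => k _; exact: eT.
  rewrite exchange_big; apply: eq_bigr => a _ /=.
  rewrite /S -series_exp_phase mulr_sumr; apply: eq_bigr => k _.
  by rewrite [(\row_a0 _) _ _]mxE /z mulrCA.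
have cC a : (fun N => series (cos_coeff (- (phi * Lam 0 a))) N) @ \oo --> cos (- (phi * Lam 0 a)).
  by rewrite cos.unlock; exact: is_cvg_series_cos_coeff.
have cS a : (fun N => series (sin_coeff (- (phi * Lam 0 a))) N) @ \oo --> sin (- (phi * Lam 0 a)).
  by rewrite sin.unlock; exact: is_cvg_series_sin_coeff.
rewrite /expmx; apply: limn_mx; apply: near_mx_ReIm => i j.
- under eq_fun do rewrite eS Re_sum; rewrite eE Re_sum.
  apply: cvg_big => [x|a _]; first exact: add_continuous.
  rewrite mxE; case: (c i j a) => u v /=.
  by apply: cvgB; apply: cvgMl_tmp.
- under eq_fun do rewrite eS Im_sum; rewrite eE Im_sum.
  apply: cvg_big => [x|a _]; first exact: add_continuous.
  rewrite mxE; case: (c i j a) => u v /=.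
  by apply: cvgD; apply: cvgMl_tmp.
Qed.

End MatrixExponential.

(** * The unitary evolution *)

Section Evolution.
Variable R : realType.
Local Notation C := (complex R).

(** Conjugation by [u] keeps the eigenvalues and turns the eigenvectors [Q] into [u *m Q]; since [u]
    commutes with [K], the entries of [K] in the two eigenbases agree. *)
Lemma skew_info_unitary_conj d (u K rho : 'M[C]_d) : u \is unitarymx ->
  K *m u = u *m K -> K ^t* = K -> psdmx rho ->
  skew_info (u *m rho *m u ^t*) K = skew_info rho K.
Proof.
move=> hu uK hK /psd_conj_diag[Q hQ [p p0 ->]].
have huQ : u *m Q \is unitarymx by rewrite mul_unitarymx.
rewrite conj_diag_mul (skew_info_eigenbasis huQ p0 hK) (skew_info_eigenbasis hQ p0 hK).
suff -> : (u *m Q) ^t* *m K *m (u *m Q) = Q ^t* *m K *m Q by [].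
rewrite adjmxM -(mulmxA (Q ^t*)) -(mulmxA (Q ^t*)) -(mulmxA (Q ^t*)); congr (_ *m _).
by rewrite (mulmxA _ u) -(mulmxA _ K u) uK (mulmxA _ u K) mul_adj_unitary // mul1mx.
Qed.

(** The left-hand side is what the product rule yields; conjugating [- 'i] in the second term
    produces the sign of the commutator. *)
Lemma evolution_generator d (u K rho : 'M[C]_d) : K ^t* = K ->
  (- 'i *: (K *m u) *m rho) *m u ^t* + u *m rho *m (- 'i *: (K *m u)) ^t* =
  - 'i *: (K *m (u *m rho *m u ^t*) - (u *m rho *m u ^t*) *m K).
Proof.
move=> hK; have ci : (- 'i : C)^* = 'i.
  by apply: (canLR conjCK); rewrite conjCi.
rewrite adjmxZ adjmxM hK ci scalerBr -!scalemxAl -!scalemxAr !mulmxA.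
by rewrite (scaleNr _ (_ *m K)) opprK.
Qed.

Section PhaseOperator.
Variables (d : nat) (W : 'M[C]_d) (kappa : 'rV[R]_d).
Hypothesis hW : W \is unitarymx.

(** The unitary $e^{-isK}$ in spectral form, for [K = conj_diag W kappa]. *)
Definition phase_op (s : R) : 'M[C]_d :=
  W *m diag_mx (\row_k phase (- (s * kappa 0 k))) *m W ^t*.

Lemma phase_op_unitary s : phase_op s \is unitarymx.
Proof.
apply/unitarymxP; rewrite /phase_op unitary_conj_adj unitary_conjM //.
rewrite tr_diag_mx map_diag_mx mulmx_diag.
set v := \row_i _; have -> : v = const_mx 1.
  by apply/rowP => k; rewrite !mxE mul_phase_conj.
by rewrite diag_const_mx mulmx1 (unitarymxP hW).
Qed.

Lemma phase_op_comm s :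
  conj_diag W kappa *m phase_op s = phase_op s *m conj_diag W kappa.
Proof. by rewrite /phase_op /conj_diag !(unitary_conjM hW) (diag_mxC (map_mx _ _)). Qed.

Lemma phase_op_derive t :
  is_mxderive phase_op t (- 'i *: (conj_diag W kappa *m phase_op t)).
Proof.
pose e s : 'M[C]_d := diag_mx (\row_k phase (- (s * kappa 0 k))).
pose De : 'M[C]_d := - 'i *: (diag_mx (map_mx (real_complex R) kappa) *m e t).
have he : is_mxderive e t De.
  move=> i j; rewrite /De scalemxE mul_diag_mxE [map_mx _ _ _ _]mxE.
  have eE s : e s i j = phase (- (s * kappa 0 i)) * (i == j)%:R.
    by rewrite !mxE; case: eqP => [->|_]; rewrite ?mulr1 ?mulr0.
  under eq_fun do rewrite eE.
  have := is_cderiveM (phase_derive (kappa 0 i) t) (is_cderive_cst ((i == j)%:R : C) t).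
  by rewrite mulr0 addr0 eE !mulrA.
(* The derivative is put in the shape given by the product rule with the constant outer factors [W]
   and [W ^t*]. *)
have -> : - 'i *: (conj_diag W kappa *m phase_op t) = (0 *m e t + W *m De) *m W ^t* + (W *m e t) *m 0.
  rewrite mul0mx add0r mulmx0 addr0 /De -scalemxAr -scalemxAl.
  by rewrite /phase_op /conj_diag unitary_conjM.
by apply: is_mxderiveM (is_mxderive_cst _ _); apply: is_mxderiveM => //; exact: is_mxderive_cst.
Qed.

End PhaseOperator.

Section Covariance.
Variables (d : nat) (W : 'M[C]_d) (kappa : 'rV[R]_d) (rho : 'M[C]_d).
Hypotheses (hW : W \is unitarymx) (hrho : density rho).

Let K := conj_diag W kappa.
Let U := phase_op W kappa.
Let f s := U s *m rho *m (U s) ^t*.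

Lemma phase_evolution_is_mxderive t :
  is_mxderive f t (- 'i *: (K *m f t - f t *m K)).
Proof.
have hU := phase_op_derive kappa hW t.
have hf := is_mxderiveM (is_mxderiveM hU (is_mxderive_cst rho t)) (is_mxderive_adj hU).
by move: hf; rewrite mulmx0 addr0 evolution_generator ?conj_diag_adj.
Qed.

Lemma phase_evolution_derive t :
  mxderive f t = - 'i *: (K *m f t - f t *m K).
Proof. exact/mxderive_val/phase_evolution_is_mxderive. Qed.

Lemma phase_evolution_differentiable t : is_mxderive f t (mxderive f t).
Proof. by rewrite phase_evolution_derive; exact: phase_evolution_is_mxderive. Qed.

Lemma phase_evolution_trace t : \tr (f t) = 1.
Proof. by rewrite /f mxtrace_unitary_conj ?phase_op_unitary //; exact: hrho.2. Qed.

Lemma skew_info_phase_evolution t : skew_info (f t) K = skew_info rho K.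
Proof.
apply: skew_info_unitary_conj; [exact: phase_op_unitary | exact: phase_op_comm | |].
  exact: conj_diag_adj.
exact: hrho.1.
Qed.

(** The evolved state has the eigenvalues of [rho] and the eigenvectors [U t *m Q], so the
    eigenbasis formulas apply at every time. *)
Lemma phase_evolution_sld t : exists L : 'M[C]_d,
  [/\ L ^t* = L, is_sld f t L, \tr (f t *m L) = 0 &
      4 * skew_info (f t) K <= complex.Re (\tr (f t *m (L *m L)))].
Proof.
have [Q hQ [p p0 eQ]] := psd_conj_diag hrho.1.
have ef : f t = conj_diag (U t *m Q) p by rewrite /f eQ conj_diag_mul.
have hUQ : U t *m Q \is unitarymx by rewrite mul_unitarymx ?phase_op_unitary.
exists (eigenbasis_sld (U t *m Q) K p).
have hK : K ^t* = K by rewrite conj_diag_adj.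
split; first exact: eigenbasis_sld_adj.
- by rewrite /is_sld phase_evolution_derive ef eigenbasis_sldP.
- by rewrite ef eigenbasis_sld_trace0.
- by rewrite ef; exact: skew_info_le_fisher_eigenbasis.
Qed.

End Covariance.

Lemma evolutionE m n (V : 'M[C]_m) (Lam : 'rV[R]_m) s : V \is unitarymx ->
  evolution n (conj_diag V Lam) s =
  phase_op (V *t (1%:M : 'M[C]_n)) (tens_row n Lam) s.
Proof.
move=> hV; rewrite /evolution expmx_conj_diag // /phase_op adjmx_tens adjmx1.
have -> : (\row_k phase (- (s * tens_row n Lam 0 k))) =
    tens_row n (\row_k phase (- (s * Lam 0 k))) by apply/rowP => k; rewrite !mxE.
by rewrite -diag_mx_tens1 !mxtens.tensmx_mul !mulmx1.
Qed.

End Evolution.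

(** * Compactness of the unitary group *)

Section Compactness.
Variable R : realType.
Local Notation C := (complex R).

Section ContinuousMatrices.
Variable T : topologicalType.

Definition ccontinuous (f : T -> C) : Prop :=
  continuous (fun x => complex.Re (f x)) /\ continuous (fun x => complex.Im (f x)).

Lemma ccontinuous_cst (c : C) : ccontinuous (fun=> c).
Proof. by split => x; exact: cvg_cst. Qed.

Lemma ccontinuousM (f g : T -> C) :
  ccontinuous f -> ccontinuous g -> ccontinuous (fun x => f x * g x).
Proof.
move=> [f1 f2] [g1 g2]; split.
- have -> : (fun x => complex.Re (f x * g x)) = (fun x =>
    complex.Re (f x) * complex.Re (g x) - complex.Im (f x) * complex.Im (g x)).
    by apply/funext => x; case: (f x); case: (g x).
  by move=> x; apply: cvgB; apply: cvgM; [exact: f1|exact: g1|exact: f2|exact: g2].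
- have -> : (fun x => complex.Im (f x * g x)) = (fun x =>
    complex.Re (f x) * complex.Im (g x) + complex.Im (f x) * complex.Re (g x)).
    by apply/funext => x; case: (f x); case: (g x).
  by move=> x; apply: cvgD; apply: cvgM; [exact: f1|exact: g2|exact: f2|exact: g1].
Qed.

Lemma ccontinuousD (f g : T -> C) :
  ccontinuous f -> ccontinuous g -> ccontinuous (fun x => f x + g x).
Proof.
move=> [f1 f2] [g1 g2]; split.
- have -> : (fun x => complex.Re (f x + g x)) =
    (fun x => complex.Re (f x) + complex.Re (g x)).
    by apply/funext => x; case: (f x); case: (g x).
  by move=> x; apply: cvgD; [exact: f1|exact: g1].
- have -> : (fun x => complex.Im (f x + g x)) =
    (fun x => complex.Im (f x) + complex.Im (g x)).
    by apply/funext => x; case: (f x); case: (g x).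
  by move=> x; apply: cvgD; [exact: f2|exact: g2].
Qed.

Lemma ccontinuous_sum (I : Type) (r : seq I) (f : I -> T -> C) :
  (forall i, ccontinuous (f i)) -> ccontinuous (fun x => \sum_(i <- r) f i x).
Proof.
move=> h; elim: r => [|i r IH].
  rewrite (_ : (fun x => _) = (fun=> 0)); first exact: ccontinuous_cst.
  by apply/funext => x; rewrite big_nil.
rewrite (_ : (fun x => _) = (fun x => f i x + \sum_(j <- r) f j x)).
  exact: ccontinuousD.
by apply/funext => x; rewrite big_cons.
Qed.

Lemma ccontinuous_conj (f : T -> C) : ccontinuous f -> ccontinuous (fun x => (f x)^* ).
Proof.
move=> [f1 f2]; split.
- have -> // : (fun x => complex.Re ((f x)^* )) = (fun x => complex.Re (f x)).
  by apply/funext => x; case: (f x).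
- have -> : (fun x => complex.Im ((f x)^* )) = (fun x => - complex.Im (f x)).
    by apply/funext => x; case: (f x).
  by move=> x; apply: cvgN; exact: f2.
Qed.

Definition mxcontinuous m n (f : T -> 'M[C]_(m, n)) : Prop :=
  forall i j, ccontinuous (fun x => f x i j).

Lemma mxcontinuous_cst m n (A : 'M[C]_(m, n)) : mxcontinuous (fun=> A).
Proof. by move=> i j; exact: ccontinuous_cst. Qed.

Lemma mxcontinuousM m n p (f : T -> 'M[C]_(m, n)) (g : T -> 'M[C]_(n, p)) :
  mxcontinuous f -> mxcontinuous g -> mxcontinuous (fun x => f x *m g x).
Proof.
move=> hf hg i j.
have -> : (fun x => (f x *m g x) i j) = (fun x => \sum_k f x i k * g x k j).
  by apply/funext => x; rewrite mxE.
by apply: ccontinuous_sum => k; exact: ccontinuousM.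
Qed.

Lemma mxcontinuousB m n (f g : T -> 'M[C]_(m, n)) :
  mxcontinuous f -> mxcontinuous g -> mxcontinuous (fun x => f x - g x).
Proof.
move=> hf hg i j.
have -> : (fun x => (f x - g x) i j) = (fun x => f x i j + (-1) * g x i j).
  by apply/funext => x; rewrite submxE mulN1r.
by apply: ccontinuousD => //; apply: ccontinuousM => //; exact: ccontinuous_cst.
Qed.

Lemma mxcontinuous_adj m n (f : T -> 'M[C]_(m, n)) :
  mxcontinuous f -> mxcontinuous (fun x => (f x) ^t*).
Proof.
move=> hf i j; have -> : (fun x => ((f x) ^t*) i j) = (fun x => (f x j i)^* ).
  by apply/funext => x; rewrite adjmxE.
exact: ccontinuous_conj.
Qed.

Lemma mxcontinuous_tens1 m n (f : T -> 'M[C]_m) :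
  mxcontinuous f -> mxcontinuous (fun x => f x *t (1%:M : 'M[C]_n)).
Proof.
move=> hf i j; case: (mxtens.mxtens_indexP i) => i0 i1.
case: (mxtens.mxtens_indexP j) => j0 j1.
have -> : (fun x => (f x *t (1%:M : 'M[C]_n)) (mxtens.mxtens_index (i0, i1))
    (mxtens.mxtens_index (j0, j1))) = (fun x => f x i0 j0 * (1%:M : 'M[C]_n) i1 j1).
  by apply/funext => x; rewrite mxtens.tensmxE.
by apply: ccontinuousM => //; exact: ccontinuous_cst.
Qed.

Lemma ccontinuous_trace m (f : T -> 'M[C]_m) :
  mxcontinuous f -> ccontinuous (fun x => \tr (f x)).
Proof. by move=> hf; apply: ccontinuous_sum => i; exact: hf. Qed.

End ContinuousMatrices.

(* Real coordinates on complex matrices: Heine-Borel is available for real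
   row vectors only. *)
Definition mx_of_coords m (v : 'rV[R]_(m * m + m * m)) : 'M[C]_m :=
  \matrix_(i, j) Complex (v 0 (lshift _ (mxvec_index i j)))
                         (v 0 (rshift _ (mxvec_index i j))).

Lemma mx_of_coords_surj m (M : 'M[C]_m) : exists v, mx_of_coords v = M.
Proof.
exists (row_mx (mxvec (map_mx (@complex.Re R) M)) (mxvec (map_mx (@complex.Im R) M))).
apply/matrixP => i j; rewrite mxE row_mxEl row_mxEr !mxvecE !mxE.
by case: (M i j).
Qed.

Lemma mx_of_coords_continuous m : mxcontinuous (@mx_of_coords m).
Proof.
move=> i j; split.
- have -> : (fun v => complex.Re (@mx_of_coords m v i j)) =
    (fun v => v 0 (lshift _ (mxvec_index i j))) by apply/funext => v; rewrite mxE.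
  exact: coord_continuous.
- have -> : (fun v => complex.Im (@mx_of_coords m v i j)) =
    (fun v => v 0 (rshift _ (mxvec_index i j))) by apply/funext => v; rewrite mxE.
  exact: coord_continuous.
Qed.

(** Each row of a unitary matrix has unit norm. This gives the boundedness half of compactness. *)
Lemma unitary_entry_le1 m (V : 'M[C]_m) i j : V \is unitarymx -> sqnorm (V i j) <= 1.
Proof.
move=> hV; have h : \sum_k V i k * (V ^t*) k i = 1.
  by move/unitarymxP/matrixP/(_ i i): hV; rewrite mxE [RHS]mxE eqxx.
have e : \sum_k sqnorm (V i k) = 1.
  apply: (@complexI R); rewrite rmorph_sum rmorph1 -h; apply: eq_bigr => k _.
  by rewrite adjmxE mul_conj_sqnorm.
by rewrite -e (bigD1 j) //= lerDl sumr_ge0 // => k _; exact: sqnorm_ge0.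
Qed.

(** The set is closed, being the zero set of a continuous function, and lies in the compact cube
    with sides [-1, 1]. *)
Lemma compact_unitary_coords m :
  compact [set v : 'rV[R]_(m * m + m * m) | mx_of_coords v \is unitarymx].
Proof.
set A := [set _ | _].
have cA : closed A.
  (* The function [g] below is the squared Frobenius norm of this defect from unitarity. *)
  pose h v := mx_of_coords v *m (@mx_of_coords m v) ^t* - 1%:M.
  pose g v := \sum_i \sum_j sqnorm (h v i j).
  have -> : A = g @^-1` [set x | x = 0].
    apply/seteqP; split => v /=.
      move=> /unitarymxP e; rewrite /g /h e subrr big1 // => i _; rewrite big1 // => j _.
      by rewrite mxE /sqnorm /= expr0n addr0.
    move=> g0; apply/unitarymxP; apply/eqP; rewrite -subr_eq0; apply/eqP/matrixP => i j.
    rewrite [RHS]mxE; apply: sqnorm0_eq0.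
    have s0 k : 0 <= \sum_l sqnorm (h v k l) by apply: sumr_ge0 => l _; exact: sqnorm_ge0.
    have /psumr_eq0P := g0; move=> /(_ (fun k _ => s0 k) i isT) /psumr_eq0P.
    by apply => // l _; exact: sqnorm_ge0.
  have hh : mxcontinuous h.
    apply: mxcontinuousB; last exact: mxcontinuous_cst.
    by apply: mxcontinuousM; [|apply: mxcontinuous_adj]; exact: mx_of_coords_continuous.
  apply: closed_comp; last exact: closed_eq.
  have -> : g = (fun v => complex.Re (\sum_i \sum_j h v i j * (h v i j)^* )).
    apply/funext => v; rewrite Re_sum; apply: eq_bigr => i _; rewrite Re_sum.
    by apply: eq_bigr => j _; rewrite mul_conj_sqnorm.
  have [cg _] : ccontinuous (fun v => \sum_i \sum_j h v i j * (h v i j)^* ).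
    apply: ccontinuous_sum => i; apply: ccontinuous_sum => j.
    by apply: ccontinuousM => //; exact: ccontinuous_conj.
  by move=> v _; exact: cg.
apply: subclosed_compact cA (rV_compact (fun=> @segment_compact R (-1) 1)) _.
move=> v hv k /=; rewrite in_itv /= -ler_norml.
have sq x : x ^+ 2 <= 1 -> `|x : R| <= 1.
  by rewrite -[X in _ <= X -> _](expr1n _ 2) -real_normK ?num_real // ler_pXn2r ?nnegrE.
apply: sq; rewrite -(fintype.splitK k); case: (fintype.split k) => l /=; case/mxvec_indexP: l => i j.
- apply: le_trans (unitary_entry_le1 i j hv); rewrite /sqnorm mxE /= lerDl sqr_ge0 //.
- apply: le_trans (unitary_entry_le1 i j hv); rewrite /sqnorm mxE /= lerDr sqr_ge0 //.
Qed.

(** With [sqrtmx rho] held constant, the skew information is a polynomial in the coordinates of [V],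
    hence continuous, and the extreme value theorem applies on the unitary group. *)
Lemma skew_info_min m n (rho : 'M[C]_(m * n)) (Lam : 'rV[R]_m) :
  exists2 V : 'M[C]_m, V \is unitarymx & forall V' : 'M[C]_m, V' \is unitarymx ->
    skew_info rho (conj_diag V Lam *t (1%:M : 'M[C]_n)) <=
    skew_info rho (conj_diag V' Lam *t (1%:M : 'M[C]_n)).
Proof.
pose F v := skew_info rho (conj_diag (@mx_of_coords m v) Lam *t (1%:M : 'M[C]_n)).
have cF : continuous F.
  have hK : mxcontinuous (fun v => conj_diag (@mx_of_coords m v) Lam *t (1%:M : 'M[C]_n)).
    apply: mxcontinuous_tens1; have hv := @mx_of_coords_continuous m.
    apply: mxcontinuousM; last exact: mxcontinuous_adj.
    by apply: mxcontinuousM => //; exact: mxcontinuous_cst.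
  have hs : mxcontinuous (fun v : 'rV[R]_(m * m + m * m) => sqrtmx rho).
    exact: mxcontinuous_cst.
  have hc := mxcontinuousB (mxcontinuousM hs hK) (mxcontinuousM hK hs).
  have ht := ccontinuous_trace (mxcontinuousM hc hc).
  exact: (ccontinuousM (ccontinuous_cst _ (- 2^-1)) ht).1.
have [v hv hmin] : exists2 v, v \in [set v | @mx_of_coords m v \is unitarymx] &
    forall w, w \in [set v | @mx_of_coords m v \is unitarymx] -> F v <= F w.
  apply: compact_EVT_min; last exact: continuous_subspaceT.
  - have [v ev] := mx_of_coords_surj (1%:M : 'M[C]_m).
    by exists v; rewrite /= ev; apply/unitarymxP; rewrite adjmx1 mulmx1.
  - exact: compact_unitary_coords.
exists (mx_of_coords v); first by move: hv; rewrite inE.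
move=> V' hV'; have [w ew] := mx_of_coords_surj V'.
by rewrite -ew; apply: hmin; rewrite inE /= ew.
Qed.

End Compactness.

(** * Vanishing skew information and zero discord *)

Section ZeroDiscord.
Variable R : realType.
Local Notation C := (complex R).

(** A vanishing sum of nonnegative terms forces [p a = p b] wherever [k a b] is nonzero, which is
    commutation with the diagonal matrix of eigenvalues. *)
Lemma skew_info_eq0_comm d (rho K : 'M[C]_d) : psdmx rho -> K ^t* = K ->
  skew_info rho K = 0 -> rho *m K = K *m rho.
Proof.
move=> /psd_conj_diag[Q hQ [p p0 ->]] hK; rewrite (skew_info_eigenbasis hQ p0 hK).
set k := Q ^t* *m K *m Q => /eqP.
rewrite mulf_eq0 invr_eq0 pnatr_eq0 /= => /eqP s0.
have t0 a b : 0 <= (Num.sqrt (p 0 a) - Num.sqrt (p 0 b)) ^+ 2 * sqnorm (k a b).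
  by rewrite mulr_ge0 ?sqr_ge0 ?sqnorm_ge0.
have z a b : real_complex R (p 0 a) * k a b = k a b * real_complex R (p 0 b).
  have /psumr_eq0P := s0.
  move=> /(_ (fun a _ => sumr_ge0 _ (fun b _ => t0 a b)) a isT)/psumr_eq0P.
  move=> /(_ (fun b _ => t0 a b) b isT)/eqP; rewrite mulf_eq0 sqrf_eq0 subr_eq0.
  move=> /orP[/eqP e|/eqP /sqnorm0_eq0 ->]; last by rewrite mulr0 mul0r.
  by rewrite -(sqr_sqrtr (p0 a)) e sqr_sqrtr // mulrC.
have eK : K = Q *m k *m Q ^t*.
  by rewrite /k !mulmxA (unitarymxP hQ) mul1mx -mulmxA (unitarymxP hQ) mulmx1.
clearbody k; rewrite eK /conj_diag !(unitary_conjM hQ).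
suff -> : diag_mx (map_mx (real_complex R) p) *m k = k *m diag_mx (map_mx (real_complex R) p) by [].
by apply/matrixP => a b; rewrite mul_diag_mxE mul_mx_diagE ![map_mx _ _ _ _]mxE.
Qed.

Lemma unitary_conjVK d (V A : 'M[C]_d) : V \is unitarymx ->
  V ^t* *m (V *m A *m V ^t*) *m V = A.
Proof.
by move=> hV; rewrite !mulmxA mul_adj_unitary // mul1mx -mulmxA mul_adj_unitary // mulmx1.
Qed.

(** In the basis [W] commutation says that [q k - q l] times the (k, l) entry is zero. *)
Lemma comm_conj_diag_eq0 d (W A : 'M[C]_d) (q : 'rV[R]_d) k l : W \is unitarymx ->
  A *m conj_diag W q = conj_diag W q *m A -> q 0 k != q 0 l ->
  (W ^t* *m A *m W) k l = 0.
Proof.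
move=> hW; have eA : A = W *m (W ^t* *m A *m W) *m W ^t*.
  by rewrite !mulmxA (unitarymxP hW) mul1mx -mulmxA (unitarymxP hW) mulmx1.
move: (_ *m W) eA => S -> {A}; rewrite /conj_diag !(unitary_conjM hW).
move=> /(congr1 (fun X => W ^t* *m X *m W)); rewrite !(unitary_conjVK _ hW).
move=> /matrixP/(_ k l); rewrite mul_mx_diagE mul_diag_mxE ![map_mx _ _ _ _]mxE.
rewrite mulrC => /eqP; rewrite -subr_eq0 -mulrBl mulf_eq0 subr_eq0.
by move=> /orP[/eqP/complexI -> /eqP //|/eqP].
Qed.

Lemma mul_delta_adj m (V : 'M[C]_m) i :
  V *m delta_mx i i *m V ^t* = col i V *m (col i V) ^t*.
Proof.
rewrite colE adjmxM -(mul_delta_mx (0 : 'I_1)) !mulmxA.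
suff -> : (delta_mx i 0 : 'cV[C]_m) ^t* = delta_mx 0 i by [].
by rewrite trmx_delta map_delta_mx.
Qed.

Lemma tensmxZr m n p q (A : 'M[C]_(m, n)) (c : C) (B : 'M[C]_(p, q)) :
  A *t (c *: B) = c *: (A *t B).
Proof.
apply/matrixP => k l; case: (mxtens.mxtens_indexP k) => i a.
case: (mxtens.mxtens_indexP l) => j b.
by rewrite scalemxE !mxtens.tensmxE scalemxE mulrCA.
Qed.

Lemma psdmx_conj m n (A : 'M[C]_m) (P : 'M[C]_(m, n)) :
  psdmx A -> psdmx (P ^t* *m A *m P).
Proof.
move=> [/hermsymmxP hA h]; split.
  by apply/hermsymmxP; rewrite !adjmxM trmxCK hA mulmxA.
by move=> x; have := h (P *m x); rewrite adjmxM !mulmxA.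
Qed.

(** The submatrix is a congruence of [A] by the columns of the identity selected by [f]. *)
Lemma psdmx_mxsub m n (A : 'M[C]_m) (f : 'I_n -> 'I_m) :
  psdmx A -> psdmx (mxsub f f A).
Proof.
move=> hA; have := psdmx_conj (colsub f 1%:M) hA.
suff -> : (colsub f (1%:M : 'M[C]_m)) ^t* = rowsub f 1%:M.
  by rewrite -rowsubE mulmx_colsub mulmx1 -mxsubcr.
by apply/matrixP => i j; rewrite adjmxE !mxE eq_sym conjC_nat.
Qed.

Lemma psdmx_trace n (A : 'M[C]_n) : psdmx A ->
  0 <= complex.Re (\tr A) /\ \tr A = real_complex R (complex.Re (\tr A)).
Proof.
move=> /psd_conj_diag[Q hQ [q q0 ->]]; rewrite /conj_diag mxtrace_unitary_conj //.
have -> : \tr (diag_mx (map_mx (real_complex R) q)) = real_complex R (\sum_i q 0 i).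
  by rewrite mxtrace_diag rmorph_sum; apply: eq_bigr => i _; rewrite mxE.
by split=> //=; apply: sumr_ge0.
Qed.

Lemma psdmx_trace_eq0 n (A : 'M[C]_n) : psdmx A -> complex.Re (\tr A) = 0 -> A = 0.
Proof.
move=> /psd_conj_diag[Q hQ [q q0 ->]]; rewrite /conj_diag mxtrace_unitary_conj //.
have -> : \tr (diag_mx (map_mx (real_complex R) q)) = real_complex R (\sum_i q 0 i).
  by rewrite mxtrace_diag rmorph_sum; apply: eq_bigr => i _; rewrite mxE.
move=> /= /psumr_eq0P s0; suff -> : map_mx (real_complex R) q = 0.
  by rewrite linear0 mulmx0 mul0mx.
by apply/rowP => i; rewrite !mxE s0.
Qed.

Lemma psdmxZ n (A : 'M[C]_n) (c : R) : 0 <= c -> psdmx A -> psdmx (real_complex R c *: A).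
Proof.
move=> c0 [/hermsymmxP hA h]; split.
  by apply/hermsymmxP; rewrite adjmxZ conj_real_complex hA.
by move=> x; rewrite -scalemxAr -scalemxAl scalemxE mulr_ge0 // ler0c.
Qed.

Lemma psd_normalize n (A : 'M[C]_n) : psdmx A -> complex.Re (\tr A) != 0 ->
  density (real_complex R (complex.Re (\tr A))^-1 *: A).
Proof.
move=> hA t0; have [tge0 et] := psdmx_trace hA; split; first by apply: psdmxZ; rewrite ?invr_ge0.
by rewrite mxtraceZ [X in _ * X]et -rmorphM /= mulVf.
Qed.

(** Nondegeneracy gives distinct blocks distinct eigenvalues, so [rho] in the basis [W] is block
    diagonal. The probabilities are the traces of the diagonal blocks, and the states of B are the
    normalized blocks. *)
Lemma zero_discord_of_comm m n (rho : 'M[C]_(m * n)) (V : 'M[C]_m) (Lam : 'rV[R]_m) :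
  density rho -> V \is unitarymx -> nondegenerate_spectrum Lam ->
  rho *m (conj_diag V Lam *t (1%:M : 'M[C]_n)) =
    (conj_diag V Lam *t (1%:M : 'M[C]_n)) *m rho ->
  zero_discord rho.
Proof.
move=> [hrho trrho] hV hLam; set W := V *t (1%:M : 'M[C]_n).
have hW : W \is unitarymx by exact: tens1_unitary.
rewrite conj_diag_tens1 -/W => hcomm.
pose S := W ^t* *m rho *m W.
have eS : rho = W *m S *m W ^t*.
  by rewrite /S !mulmxA (unitarymxP hW) mul1mx -mulmxA (unitarymxP hW) mulmx1.
have psdS : psdmx S by exact: psdmx_conj.
have trS : \tr S = 1 by rewrite -trrho eS mxtrace_unitary_conj.
pose idx i a : 'I_(m * n) := mxtens.mxtens_index (i, a).
have off i j a b : i != j -> S (idx i a) (idx j b) = 0.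
  move=> ij; apply: comm_conj_diag_eq0 hW hcomm _; rewrite !mxE !mxtens.mxtens_indexK /=.
  by apply: contra_neq ij => /hLam.
pose s i : 'M[C]_n := mxsub (idx i) (idx i) S.
have psds i : psdmx (s i) by exact: psdmx_mxsub.
pose p i := complex.Re (\tr (s i)).
have sump : \sum_i p i = 1.
  suff e : \sum_i \tr (s i) = \tr S by rewrite -Re_sum e trS.
  rewrite /mxtrace pair_bigA [RHS](reindex (@mxtens.mxtens_index m n)) /=.
    by apply: eq_bigr => -[i a] _; rewrite mxE.
  by exists (@mxtens.mxtens_unindex m n) => ? _;
    rewrite (mxtens.mxtens_indexK, mxtens.mxtens_unindexK).
(* A block of zero trace is zero and leaves its state arbitrary, but some state must be supplied;
   the normalized block [j] serves. *)
have [j pj] : exists j, p j != 0.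
  apply: contrapT => h; have /eqP := sump; rewrite big1 ?(eq_sym 0) ?oner_eq0 // => i _.
  by apply/eqP; apply: contrapT => hi; apply: h; exists i; apply/negP.
have htau i : exists tau, density tau /\ s i = real_complex R (p i) *: tau.
  have [pi0|pi0] := eqVneq (p i) 0.
    exists (real_complex R (p j)^-1 *: s j); split; first exact: psd_normalize.
    by rewrite pi0 rmorph0 scale0r; exact: psdmx_trace_eq0.
  exists (real_complex R (p i)^-1 *: s i); split; first exact: psd_normalize.
  by rewrite scalerA -rmorphM /= divff // scale1r.
have {htau}[tau htau] := choice htau.
exists V, p, tau; split => //.
- by split => // i; have [] := psdmx_trace (psds i).
- by move=> i; have [] := htau i.
have eS' : S = \sum_i (delta_mx i i *t s i).
  apply/matrixP => k l; case: (mxtens.mxtens_indexP k) => i a.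
  case: (mxtens.mxtens_indexP l) => i' b; rewrite summxE.
  under eq_bigr do rewrite mxtens.tensmxE mxE.
  have [<-|ii'] := eqVneq i i'.
    rewrite (bigD1 i) //= eqxx mul1r big1 => [|i'' ni]; first by rewrite addr0 [RHS]mxE.
    by rewrite andbb eq_sym (negPf ni) mul0r.
  rewrite (off _ _ _ _ ii') big1 // => i'' _.
  by have [e|] := eqVneq i i''; rewrite ?mul0r // -e eq_sym (negPf ii') mul0r.
rewrite eS eS' mulmx_sumr mulmx_suml; apply: eq_bigr => i _.
rewrite /W adjmx_tens adjmx1 !mxtens.tensmx_mul mul1mx mulmx1 (htau i).2.
by rewrite mul_delta_adj tensmxZr.
Qed.

End ZeroDiscord.

(** * Optimal estimation *)

Section IndependentCopies.
Variables (R : realType) (X : finType) (P l : X -> R) (nu : nat).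
Hypothesis P1 : \sum_y P y = 1.
Implicit Types x : {ffun 'I_nu -> X}.

(** Independence of the copies, obtained by distributing the product over the sums. *)
Lemma expectation_prod (a : 'I_nu -> X -> R) :
  \sum_(x : {ffun 'I_nu -> X}) (\prod_(j < nu) P (x j)) * \prod_j a j (x j) = \prod_j \sum_y P y * a j y.
Proof. by rewrite bigA_distr_bigA /=; apply: eq_bigr => x _; rewrite big_split. Qed.

Lemma expectation_total : \sum_(x : {ffun 'I_nu -> X}) \prod_(j < nu) P (x j) = 1.
Proof.
by rewrite -(bigA_distr_bigA (fun _ : 'I_nu => P)) big1.
Qed.

(** Padding with ones writes a function of a single outcome as a product over all copies, the form
    required by [expectation_prod]. *)
Let pick (k j : 'I_nu) (y : X) : R := if j == k then l y else 1.

Let prod_pick k x : \prod_j pick k j (x j) = l (x k).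
Proof. by rewrite /pick -big_mkcond big_pred1_eq. Qed.

Lemma expectation_single k :
  \sum_(x : {ffun 'I_nu -> X}) (\prod_(j < nu) P (x j)) * l (x k) = \sum_y P y * l y.
Proof.
under eq_bigr do rewrite -prod_pick; rewrite expectation_prod (bigD1 k) //= {1}/pick eqxx.
rewrite [X in _ * X]big1 ?mulr1 // => j jk; rewrite /pick (negPf jk).
by under eq_bigr do rewrite mulr1.
Qed.

Lemma expectation_pair k k' : \sum_y P y * l y = 0 ->
  \sum_(x : {ffun 'I_nu -> X}) (\prod_(j < nu) P (x j)) * (l (x k) * l (x k')) =
  (\sum_y P y * l y ^+ 2) *+ (k == k').
Proof.
move=> l0; under eq_bigr do rewrite -!prod_pick -big_split /=.
rewrite (expectation_prod (fun j y => pick k j y * pick k' j y)) (bigD1 k) //= {1 2}/pick eqxx.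
have [<-|kk'] := eqVneq k k'.
  rewrite [X in _ * X]big1 ?mulr1 // => j jk; rewrite /pick (negPf jk).
  by under eq_bigr do rewrite !mulr1.
by under eq_bigr do rewrite mulr1; rewrite l0 mul0r.
Qed.

Lemma expectation_sum :
  \sum_(x : {ffun 'I_nu -> X}) (\prod_(j < nu) P (x j)) * (\sum_j l (x j)) = nu%:R * \sum_y P y * l y.
Proof.
under eq_bigr do rewrite mulr_sumr.
rewrite exchange_big /=; under eq_bigr do rewrite expectation_single.
by rewrite sumr_const card_ord mulr_natl.
Qed.

(** Expanding the square, the terms from distinct copies factor into vanishing means, and only the
    [nu] diagonal terms remain. *)
Lemma expectation_sum_sqr : \sum_y P y * l y = 0 ->
  \sum_(x : {ffun 'I_nu -> X}) (\prod_(j < nu) P (x j)) * (\sum_j l (x j)) ^+ 2 =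
  nu%:R * \sum_y P y * l y ^+ 2.
Proof.
move=> l0; transitivity (\sum_(x : {ffun 'I_nu -> X}) \sum_k \sum_k' (\prod_(j < nu) P (x j)) * (l (x k) * l (x k'))).
  apply: eq_bigr => x _; rewrite expr2 mulr_suml mulr_sumr; apply: eq_bigr => k _.
  by rewrite mulr_sumr mulr_sumr.
rewrite exchange_big /=.
transitivity (\sum_(k < nu) \sum_y P y * l y ^+ 2); last by rewrite sumr_const card_ord mulr_natl.
apply: eq_bigr => k _; rewrite exchange_big /=; under eq_bigr do rewrite expectation_pair //.
by rewrite (bigD1 k) //= eqxx mulr1n [X in _ + X]big1 ?addr0 // => j jk; rewrite eq_sym (negPf jk).
Qed.

End IndependentCopies.

(** * Projective measurement of the logarithmic derivative and its estimator *)

Section OptimalStrategy.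
Variable R : realType.
Local Notation C := (complex R).

(** For unitary [Q], the rank-one projector onto its column [x], encoded so that positivity follows
    from [psd_conj_diag_ge0]. *)
Definition eigenprojector d (Q : 'M[C]_d) (x : 'I_d) : 'M[C]_d :=
  conj_diag Q (\row_k (k == x)%:R).

Lemma sum_eigenprojector d (Q : 'M[C]_d) (l : 'rV[R]_d) :
  \sum_x real_complex R (l 0 x) *: eigenprojector Q x = conj_diag Q l.
Proof.
have E (x : 'I_d) : real_complex R (l 0 x) *: eigenprojector Q x = Q *m
    (real_complex R (l 0 x) *: diag_mx (map_mx (real_complex R) (\row_k (k == x)%:R))) *m Q ^t*.
  by rewrite /eigenprojector /conj_diag scalemxAl scalemxAr.
under eq_bigr do rewrite E.
rewrite -mulmx_suml -mulmx_sumr /conj_diag; congr (_ *m _ *m _).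
apply/matrixP => i j; rewrite summxE (bigD1 i) //= big1 => [|k ki].
  by rewrite scalemxE !mxE eqxx rmorph1 addr0; case: eqP; rewrite ?mulr1 ?mulr0.
by rewrite scalemxE !mxE eq_sym (negPf ki) rmorph0 mul0rn mulr0.
Qed.

Section Construction.
Variables (d : nat) (Q : 'M[C]_d) (hQ : Q \is unitarymx) (l : 'rV[R]_d) (phi F : R).

Lemma eigenprojector_psd x : psdmx (eigenprojector Q x).
Proof. by apply/psd_conj_diag_ge0 => // i; rewrite mxE ler0n. Qed.

Lemma eigenprojector_sum1 : \sum_x eigenprojector Q x = 1%:M.
Proof.
have := sum_eigenprojector Q (const_mx 1); under eq_bigr do rewrite mxE rmorph1 scale1r.
move=> ->; rewrite /conj_diag map_const_mx rmorph1 diag_const_mx mulmx1.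
exact/unitarymxP.
Qed.

(* Measure the logarithmic derivative and add the rescaled sample mean to the
   true value: one step of the scoring method. *)
Definition scoring_strategy : strategy R d :=
  @Strategy R d 'I_d (eigenprojector Q) eigenprojector_psd eigenprojector_sum1
    (fun nu x => phi + (nu%:R * F)^-1 * \sum_j l 0 (x j)).

(** By linearity of the Born rule, functions of the outcome average to traces against the observable
    with these values as eigenvalues. *)
Lemma sum_outcome_prob (rho : 'M[C]_d) (g : 'rV[R]_d) :
  \sum_(x : 'I_d) outcome_prob (s := scoring_strategy) rho x * g 0 x =
  complex.Re (\tr (conj_diag Q g *m rho)).
Proof.
have mxtrace_sum (A : 'I_d -> 'M[C]_d) : \tr (\sum_x A x) = \sum_x \tr (A x).
  exact: raddf_sum.
rewrite -sum_eigenprojector mulmx_suml mxtrace_sum Re_sum; apply: eq_bigr => x _.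
by rewrite -scalemxAl mxtraceZ ReM_real mulrC.
Qed.

Lemma outcome_prob_total (rho : 'M[C]_d) : \tr rho = 1 ->
  \sum_(x : 'I_d) outcome_prob (s := scoring_strategy) rho x = 1.
Proof.
move=> t1; have := sum_outcome_prob rho (const_mx 1); under eq_bigr do rewrite mxE mulr1.
move=> ->; rewrite /conj_diag map_const_mx rmorph1 diag_const_mx mulmx1.
by rewrite (unitarymxP hQ) mul1mx t1.
Qed.

Lemma mean_scoring (rho : 'M[C]_d) nu : \tr rho = 1 -> (0 < nu)%N ->
  mean_est scoring_strategy rho nu = phi + F^-1 * complex.Re (\tr (conj_diag Q l *m rho)).
Proof.
move=> t1 nu0; rewrite /mean_est /expectation_est /=.
have P1 := outcome_prob_total t1.
under eq_bigr do rewrite mulrDr.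
rewrite big_split /= -mulr_suml (expectation_total nu P1) mul1r; congr (_ + _).
under eq_bigr do rewrite mulrCA.
rewrite -mulr_sumr (expectation_sum (fun x => l 0 x) nu P1) sum_outcome_prob.
by rewrite invfM mulrA (mulrAC nu%:R^-1) mulVf ?mul1r // pnatr_eq0 -lt0n.
Qed.

(** The mean is [phi], so the deviation is the rescaled sum of [nu] centered independent outcomes,
    whose second moment grows linearly in [nu]. *)
Lemma var_scoring (rho : 'M[C]_d) nu : \tr rho = 1 -> (0 < nu)%N ->
  complex.Re (\tr (conj_diag Q l *m rho)) = 0 ->
  var_est scoring_strategy rho nu = (nu%:R * F ^+ 2)^-1 *
    complex.Re (\tr (conj_diag Q l *m conj_diag Q l *m rho)).
Proof.
move=> t1 nu0 l0; rewrite /var_est /expectation_est mean_scoring // l0 mulr0 addr0 /=.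
have P1 := outcome_prob_total t1.
under eq_bigr do rewrite addrAC subrr add0r exprMn mulrCA.
have l0' : \sum_(y : 'I_d) outcome_prob (s := scoring_strategy) rho y * l 0 y = 0.
  by rewrite sum_outcome_prob.
rewrite -mulr_sumr (expectation_sum_sqr nu P1 l0') conj_diagM // -sum_outcome_prob.
have -> : \sum_x outcome_prob (s:=scoring_strategy) rho x * (\row_i (l 0 i * l 0 i)) 0 x =
    \sum_x outcome_prob (s:=scoring_strategy) rho x * l 0 x ^+ 2.
  by apply: eq_bigr => x _; rewrite mxE expr2.
have nn : (nu%:R : R)^-1 * nu%:R = 1 by rewrite mulVf // pnatr_eq0 -lt0n.
rewrite !expr2 !invfM; set z := \sum_x _.
transitivity ((nu%:R^-1 * nu%:R) * (nu%:R^-1 * (F^-1 * F^-1)) * z); first by ring.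
by rewrite nn mul1r.
Qed.

End Construction.

Lemma mean_trace_derive d (f : R -> 'M[C]_d) (phi : R) (L D : 'M[C]_d) :
  is_mxderive f phi D ->
  is_derive phi (1 : R) (fun t => complex.Re (\tr (L *m f t))) (complex.Re (\tr (L *m D))).
Proof.
move=> hf; have h := is_mxderiveM (is_mxderive_cst L phi) hf.
rewrite mul0mx add0r in h.
by have [] := is_cderive_sum (index_enum 'I_d) (fun i => h i i).
Qed.

Lemma exists_saturating_strategy d (f : R -> 'M[C]_d) (phi : R) (L : 'M[C]_d) :
  (forall t, \tr (f t) = 1) -> is_mxderive f phi (mxderive f phi) ->
  L ^t* = L -> is_sld f phi L -> \tr (f phi *m L) = 0 -> 0 < qfi f phi ->
  exists s : strategy R d,
    (forall nu : nat, (0 < nu)%N -> locally_unbiased s f phi nu) /\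
    saturates_qcrb s f phi.
Proof.
move=> f1 df hL sld trL; rewrite /saturates_qcrb (qfiE sld); set F := complex.Re _ => F0.
have [Q hQ [l eL]] := hermitian_conj_diag hL.
have trL' : complex.Re (\tr (L *m f phi)) = 0 by rewrite mxtrace_mulC trL.
exists (scoring_strategy hQ l phi F); split=> [nu nu0|].
  split; first by rewrite mean_scoring // -eL trL' mulr0 addr0.
  under eq_fun do rewrite mean_scoring // -eL.
  have dm := mean_trace_derive L df.
  (* Tracing the equation of [L] against [L] shows that its mean has slope [F] at [phi]; the factor
     [F^-1] in the estimator makes this slope 1. *)
  have trLD : \tr (L *m mxderive f phi) = \tr (f phi *m (L *m L)).
    apply: (@mulfI _ (2 : C)); first by rewrite pnatr_eq0.
    rewrite -mxtraceZ scalemxAr sld mulmxDr mxtraceD (mxtrace_mulC L (f phi *m L)).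
    by rewrite (mulmxA L L) (mxtrace_mulC (L *m L)) -(mulmxA (f phi)) mulr2n mulrDl mul1r.
  rewrite trLD -/F in dm.
  have -> : (fun t => phi + F^-1 * complex.Re (\tr (L *m f t))) =
      cst phi + F^-1 \*: (fun t => complex.Re (\tr (L *m f t))).
    by apply/funext.
  by apply: is_derive_eq; rewrite add0r /GRing.scale /= mulVf // gt_eqF.
(* The variance equals [1 / (nu F)] exactly for every positive [nu]; only [nu = 0] has to be
   discarded. *)
apply: cvg_near_cst; near=> nu.
have nu0 : (0 < nu)%N by near: nu; exact: nbhs_infty_gt.
rewrite var_scoring // -?eL // (mxtrace_mulC _ (f phi)) -/F.
have n0 : (nu%:R : R) != 0 by rewrite pnatr_eq0 -lt0n.
have F00 : F != 0 by rewrite gt_eqF.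
by field; rewrite n0 F00.
Unshelve. all: by end_near. Qed.

End OptimalStrategy.

(** * Positivity of the local quantum uncertainty and the resulting variance bounds *)

Section LocalQuantumUncertainty.
Variables (R : realType) (m n : nat) (rho : 'M[complex R]_(m * n)) (Lam : 'rV[R]_m).

(** The existence of a minimizer rules out the default value of [xget] in [minimum]. *)
Lemma lqu_attained :
  (exists2 K, has_spectrum Lam K & lqu Lam rho = skew_info rho (K *t 1%:M)) /\
  (forall K, has_spectrum Lam K -> lqu Lam rho <= skew_info rho (K *t 1%:M)).
Proof.
have [V hV hmin] := skew_info_min rho Lam.
rewrite /lqu /minimum; set S := (X in xget _ X).
have [] : S (xget 0 S).
  apply: xgetPex; exists (skew_info rho (conj_diag V Lam *t 1%:M)); split.
    by exists (conj_diag V Lam) => //; exists V.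
  by move=> _ [K [V' hV' ->] <-]; exact: hmin.
move=> [K hK <-] hlb; split; first by exists K.
by move=> K' hK'; apply: hlb; exists K'.
Qed.

Lemma skew_info_ge0 d (sigma K : 'M[complex R]_d) :
  psdmx sigma -> K ^t* = K -> 0 <= skew_info sigma K.
Proof.
move=> /psd_conj_diag[Q hQ [p p0 ->]] hK; rewrite (skew_info_eigenbasis hQ p0 hK).
rewrite mulr_ge0 // sumr_ge0 // => a _; apply: sumr_ge0 => b _.
by rewrite mulr_ge0 ?sqr_ge0 ?sqnorm_ge0.
Qed.

(** If the value were zero, the minimizing observable would commute with [rho], and its
    nondegenerate spectrum would force zero discord. *)
Lemma lqu_gt0 : density rho -> nondegenerate_spectrum Lam -> ~ zero_discord rho ->
  0 < lqu Lam rho.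
Proof.
move=> hrho hLam; have [[_ [V hV ->] eU] _] := lqu_attained.
have hK : (conj_diag V Lam *t (1%:M : 'M[complex R]_n)) ^t* =
    conj_diag V Lam *t (1%:M : 'M[complex R]_n).
  by rewrite adjmx_tens adjmx1 conj_diag_adj.
rewrite lt_def eU skew_info_ge0 ?andbT //; last exact: hrho.1.
apply: contra_not_neq => s0; apply: zero_discord_of_comm hV hLam _ => //.
exact: skew_info_eq0_comm hrho.1 hK s0.
Qed.

End LocalQuantumUncertainty.

Lemma inv_fisher_le (R : realType) (F U : R) (nu : nat) : 0 < U -> 4 * U <= F ->
  (0 < nu)%N -> 1 / (nu%:R * F) <= 1 / (4 * nu%:R * U).
Proof.
move=> U0 UF nu0; have nuR : 0 < nu%:R :> R by rewrite ltr0n.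
have F0 : 0 < F by rewrite (lt_le_trans _ UF) // mulr_gt0.
by rewrite !div1r lef_pV2 ?posrE ?mulr_gt0 // (mulrC 4) -mulrA ler_pM2l.
Qed.

(** Convergence of the ratio to 1 bounds it eventually by [1 + e], whence the slack factor in the
    conclusion. *)
Lemma asymptotic_variance_le (R : realType) (F U : R) (v : nat -> R) :
  0 < U -> 4 * U <= F ->
  (fun nu : nat => v nu / (1 / (nu%:R * F))) @ \oo --> (1 : R) ->
  forall e : R, 0 < e ->
  \forall nu \near \oo, v nu <= (1 + e) * (1 / (4 * nu%:R * U)).
Proof.
move=> U0 UF /cvgrPdist_lt hv e e0; have F0 : 0 < F by rewrite (lt_le_trans _ UF) // mulr_gt0.
near=> nu; have nu0 : (0 < nu)%N by near: nu; exact: nbhs_infty_gt.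
have nuF : 0 < 1 / (nu%:R * F) by rewrite divr_gt0 // mulr_gt0 // ltr0n.
have /ltW : `|1 - v nu / (1 / (nu%:R * F))| < e by near: nu; exact: hv.
rewrite distrC ler_norml => /andP[_]; rewrite lerBlDl ler_pdivrMr //.
by move/le_trans; apply; rewrite ler_pM2l ?inv_fisher_le // addr_gt0.
Unshelve. all: by end_near. Qed.

Theorem mainTheorem4 (R : realType) (m n : nat)
    (rho : 'M[complex R]_(m * n)) (rho_density : density rho)
    (Lam : 'rV[R]_m) (Lam_nondeg : nondegenerate_spectrum Lam)
    (H : 'M[complex R]_m) (H_spectrum : has_spectrum Lam H)
    (phi : R) :
  let K := H *t (1%:M : 'M[complex R]_n) in
  let rho_ := evolve H rho in
  let U := lqu Lam rho in
  let F := qfi rho_ phi in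
  [/\ U <= skew_info rho K,
      skew_info rho K = skew_info (rho_ phi) K,
      skew_info (rho_ phi) K <= 1 / 4 * F &
      ~ zero_discord rho ->
      [/\ 0 < U,
          forall nu : nat, (0 < nu)%N -> 1 / (nu%:R * F) <= 1 / (4 * nu%:R * U),
          exists s : strategy R (m * n),
            (forall nu : nat, (0 < nu)%N -> locally_unbiased s rho_ phi nu) /\
            saturates_qcrb s rho_ phi &
          forall s : strategy R (m * n), saturates_qcrb s rho_ phi ->
          forall e : R, 0 < e ->
          \forall nu \near \oo,
            var_est s (rho_ phi) nu <= (1 + e) * (1 / (4 * nu%:R * U))]].
Proof.
have four (x y z t : R) : x <= y -> z = y -> 4 * z <= t -> 4 * x <= t by lra.
have quarter (x y : R) : 4 * x <= y -> x <= 1 / 4 * y by lra.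
have pos (x y : R) : 0 < x -> 4 * x <= y -> 0 < y by lra.
move=> K rho_ U F.
have U_skew : U <= skew_info rho K by have [_] := lqu_attained rho Lam; apply.
have U_gt0 : ~ zero_discord rho -> 0 < U by exact: lqu_gt0.
have [V hV eH] := H_spectrum.
have hW := tens1_unitary n hV; set W := V *t _ in hW.
(* The local generator is treated as a global one, diagonalized by [W] with each eigenvalue of [H]
   repeated [n] times; the evolution becomes [phase_op W kappa]. *)
pose kappa := tens_row n Lam.
have eK : K = conj_diag W kappa by rewrite /K eH conj_diag_tens1.
have erho : rho_ = fun t => phase_op W kappa t *m rho *m (phase_op W kappa t) ^t*.
  by apply/funext => t; rewrite /rho_ /evolve eH evolutionE.
clearbody U K rho_ W.
have skewE : skew_info (rho_ phi) K = skew_info rho K.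
  by rewrite eK erho; exact: skew_info_phase_evolution.
have [L [hL sld trL skew_le]] : exists L, [/\ L ^t* = L, is_sld rho_ phi L,
    \tr (rho_ phi *m L) = 0 &
    4 * skew_info (rho_ phi) K <= complex.Re (\tr (rho_ phi *m (L *m L)))].
  by rewrite eK erho; exact: phase_evolution_sld.
(* The Fisher information is independent of the chosen solution, so the explicit [L] computes
   [F]. *)
rewrite -(qfiE sld) -/F in skew_le.
have UF : 4 * U <= F by exact: four U_skew skewE skew_le.
split; [exact: U_skew | exact: esym skewE | exact: quarter skew_le |].
move=> hdisc.
have U0 := U_gt0 hdisc.
split; first exact: U0.
- by move=> nu; exact: inv_fisher_le.
- apply: (@exists_saturating_strategy _ _ _ _ L); [| |exact: hL|exact: sld|exact: trL|].
  + by move=> t; rewrite erho; exact: phase_evolution_trace.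
  + by rewrite erho; exact: phase_evolution_differentiable.
  + exact: pos U0 UF.
- by move=> s hs; exact: asymptotic_variance_le U0 UF hs.
Qed.
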